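(* Let $2\le p<\infty$ and let $d\ge 3$ be an integer. Then: (1) $s(\ell_p^d)=v(\ell_p^d)=3$ if $2\le p<\frac{\log 3}{\log 3-\log 2}$ ($\approx 2.70951$); (2) $s(\ell_p^d)=v(\ell_p^d)=4$ if $\frac{\log 3}{\log 3-\log 2}\le p<\frac{\log 8-\log 3}{\log 4-\log 3}$ ($\approx 3.40942$); (3) $4\le s(\ell_p^d)\le v(\ell_p^d)\le 5$ if $\frac{\log 3}{\log 3-\log 2}\le p<\frac{\log 4}{\log 4-\log 3}$ ($\approx 4.81884$); (4) $4\le s(\ell_p^d)\le v(\ell_p^d)\le 6$ if $\frac{\log 3}{\log 3-\log 2}\le p<\frac{\log 4}{\log 8-\log 7}$ ($\approx 10.3818$); (5) $4\le s(\ell_p^d)\le v(\ell_p^d)\le 7$ for all $p\ge\frac{\log 3}{\log 3-\log 2}$.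
   Context: $\ell_p^d$ is $\mathbb{R}^d$ with the norm $\|(x_1,\dots,x_d)\|_p=\bigl(\sum_{i=1}^d|x_i|^p\bigr)^{1/p}$. Let $X$ be a finite-dimensional real normed space with norm $\|\cdot\|$. For a finite set $S\subseteq X$, a Steiner Minimal Tree (SMT) of $S$ is a finite tree $T$ whose vertex set $V(T)$ satisfies $S\subseteq V(T)\subseteq X$ and whose total length $\sum_{\{x,y\}\in E(T)}\|x-y\|$ is minimal among all finite trees with vertex set $V$ satisfying $S\subseteq V\subseteq X$. The elements of $S$ are called the vertices of the SMT, and the elements of $V(T)\setminus S$ its Steiner points. $v(X)$ denotes the largest degree (in $T$) of a vertex, i.e. an element of $S$, over all SMTs $T$ of finite sets $S$ in $X$; $s(X)$ denotes the largest degree of a Steiner point over all SMTs of finite sets in $X$. *)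

(* Defs.v *)
From HB Require Import structures.
From mathcomp Require Import all_boot all_order all_algebra.
From mathcomp Require Import finmap.
From mathcomp Require Import boolp classical_sets reals exp.

Set Implicit Arguments.
Unset Strict Implicit.
Unset Printing Implicit Defensive.

Import Order.TTheory GRing.Theory Num.Theory.

Local Open Scope ring_scope.
Local Open Scope fset_scope.
Local Open Scope classical_set_scope.

Definition lp_norm (R : realType) (p : R) (d : nat) (x : 'rV[R]_d) : R :=
  (\sum_(i < d) `|x ord0 i| `^ p) `^ p^-1.
Arguments lp_norm {R} p d x.

(* [ucycle e c] with [size c = 2] is a single edge traversed back and forth,
   so only the longer ones are cycles of the graph. *)
Definition is_tree (T : finType) (e : rel T) : Prop :=
  [/\ (0 < #|T|)%N, symmetric e, irreflexive e,
      (forall x y, connect e x y) &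
      (forall c : seq T, ucycle e c -> (size c <= 2)%N)].

Definition degree (T : finType) (e : rel T) (x : T) : nat :=
  #|[set y | e x y]%SET|.

Section Steiner.
(* The norm of the space is a parameter, because the canonical norm on ['rV_d]
   is the max norm. *)
Context {R : realType} {X : vectType R} (nrm : X -> R).

(* The sum over ordered pairs counts each edge [{x, y}] twice. *)
Definition tree_length (V : {fset X}) (e : rel V) : R :=
  (\sum_(x : V) \sum_(y : V | e x y) nrm (val x - val y)) / 2.

Definition is_SMT (S V : {fset X}) (e : rel V) : Prop :=
  [/\ (S `<=` V)%fset, is_tree e &
      forall (V' : {fset X}) (e' : rel V'), (S `<=` V')%fset -> is_tree e' ->
        tree_length e <= tree_length e'].

Definition vertex_degrees : set nat :=
  [set k | exists (S V : {fset X}) (e : rel V) (x : V),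
     [/\ is_SMT S e, val x \in S & degree e x = k]].

Definition steiner_degrees : set nat :=
  [set k | exists (S V : {fset X}) (e : rel V) (x : V),
     [/\ is_SMT S e, val x \notin S & degree e x = k]].

End Steiner.

(* The value is 0 when [A] is empty or unbounded; hence a nonzero value is
   always attained and maximal. *)
Definition largest (A : set nat) : nat := xget 0%N (A `&` ubound A).

Definition v_max (R : realType) (X : vectType R) (nrm : X -> R) : nat :=
  largest (vertex_degrees nrm).

Definition s_max (R : realType) (X : vectType R) (nrm : X -> R) : nat :=
  largest (steiner_degrees nrm).

(* Main.v *)
Require Import Defs.
From HB Require Import structures.
From mathcomp Require Import all_boot all_order all_algebra.
From mathcomp Require Import finmap.
From mathcomp Require Import boolp classical_sets reals exp.
From mathcomp Require Import all_classical all_reals all_analysis.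
From mathcomp Require Import measurable_realfun ring lra.
Import Order.TTheory GRing.Theory Num.Theory.
Import numFieldNormedType.Exports.
Local Open Scope ring_scope.

(** Let [q = p / (p - 1)]. Reattaching a set [J] of edges at a vertex [x] of an
    SMT to a new point [x + z], joined to [x], and letting [z -> 0] shows that
    the norming functionals of the edges at [x] are unit vectors of l_q^d all
    of whose subset sums have norm at most 1. Conversely, unit vectors of l_q^d
    with this property and with sum zero calibrate a star with a Steiner point
    at the origin (Lawlor and Morgan); multiples of sign vectors provide stars
    of degree 3, and of degree 4 as soon as 2^q <= 3.

    The number [n] of such vectors is bounded by inequalities between reals
    [a_i], summed over the [d] coordinates. As |b|^q is a positive multiple of
    the integral of (1 - cos (b t)) t^(-1-q) over t > 0 when 0 < q < 2, they
    follow from trigonometric ones: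
    - (sum_i cos u_i)^2 <= n sum_i cos^2 u_i yields
      sum_(i,j) |a_i + a_j|^q >= (n/2) sum_i |2 a_i|^q, hence
      2^q <= 2 (n - 1) / (n - 2), which settles n = 4 and n = 5;
    - sum_J cos (sum_(i in J) u_i) = 2^n cos (sum_i u_i / 2) prod_i cos (u_i / 2)
      and the inequality of arithmetic and geometric means bound the average of
      |sum_(i in J) a_i|^q over all [J] from below, which excludes n = 7 for
      every [q], and n = 6 when 3^q > 4. *)

Set Implicit Arguments.
Unset Strict Implicit.
Unset Printing Implicit Defensive.

(** * Moments of 1 - cos *)

Section Levy.
Local Open Scope classical_set_scope.
Variable R : realType.
Local Notation mu := (@lebesgue_measure R).
Implicit Types (q l b c s t v : R) (g : R -> R).

Lemma sin_le_norm b : `|sin b| <= `|b|.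
Proof.
wlog b0 : b / 0 < b.
  move=> H; have [b0|b0|->] := ltgtP b 0; [|exact: H|by rewrite sin0 normr0].
  by rewrite -normrN -sinN -(normrN b) H// oppr_gt0.
have [x _ /eqP] := @MVT R sin cos 0 b b0 (fun x _ => is_derive_sin x)
  (continuous_subspaceT (@continuous_sin R)).
rewrite sin0 !subr0 => /eqP ->; rewrite normrM ler_piMl//.
exact: cos_max.
Qed.

(** Quadratic decay at the origin, which makes the moments converge there when [q < 2]. *)
Lemma onem_cos_le_sqr b : 1 - cos b <= b ^+ 2.
Proof.
have E : b = (b / 2) *+ 2 by rewrite -mulr_natr; field.
rewrite {1}E cos_mulr2n cos2sin2.
have : sin (b / 2) ^+ 2 <= (b / 2) ^+ 2.
  by rewrite -[leLHS]real_normK ?num_real// -[leRHS]real_normK ?num_real//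
    lerXn2r ?nnegrE// sin_le_norm.
have := sqr_ge0 b; rewrite expr_div_n => ? ?; lra.
Qed.

Lemma integrable_expRN_norm l : 0 < l ->
  mu.-integrable setT (EFin \o (fun s => expR (- (l * `|s|)))).
Proof.
move=> l0.
have cf : continuous (fun s => expR (- (l * `|s|))).
  move=> x; apply: continuous_comp; last exact: continuous_expR.
  by apply: continuousN; apply: continuousM; [exact: cst_continuous|exact: norm_continuous].
have mf : measurable_fun setT (fun s => expR (- (l * `|s|))).
  exact: continuous_measurable_fun.
apply/integrableP; split; first exact/measurable_EFinP.
under eq_integral do rewrite /= ger0_norm ?expR_ge0//.
rewrite (@ge0_symfun_integralT _ (fun s => expR (- (l * `|s|))))//; first last.
- by move=> x /=; rewrite normrN.
have -> : (\int[mu]_(x in [set x | (0 <= x)%R]) (expR (- (l * `|x|)))%:E =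
   \int[mu]_(x in [set x | (0 <= x)%R]) (l^-1%:E * (exponential_pdf l x)%:E))%E.
  apply: eq_integral => x /[!inE]/= x0; rewrite /exponential_pdf patchE.
  rewrite mem_set/= ?in_itv/= ?x0// -EFinM mulrA mulVf ?gt_eqF// mul1r.
  by rewrite ger0_norm// mulNr.
have mN : measurable [set x : R | 0 <= x] by rewrite -set_itvcy.
have mp := measurable_exponential_pdf l.
rewrite ge0_integralZl//=; last 3 first.
- by apply/measurable_EFinP; exact: measurable_funTS.
- by move=> x _; rewrite lee_fin exponential_pdf_ge0// ltW.
- by rewrite lee_fin invr_ge0 ltW.
rewrite lte_mul_pinfty ?lee_fin//; rewrite lte_mul_pinfty ?lee_fin ?invr_ge0 ?(ltW l0)//.
apply: (@le_lt_trans _ _ 1%E); last exact: ltry.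
rewrite -(integral_exponential_pdf l0); apply: ge0_subset_integral => //.
- exact/measurable_EFinP.
- by move=> x _; rewrite lee_fin exponential_pdf_ge0// ltW.
Qed.

(* The measure [expR (- q s) ds] is the image of [t `^ (- 1 - q) dt] under
   [s = ln t]; in this coordinate scaling is a translation. *)
Definition log_weight q g s : R := g (expR s) * expR (- (q * s)).

Lemma continuous_log_weight q g : continuous g -> continuous (log_weight q g).
Proof.
move=> cg s.
apply: (@continuousM _ _ (fun s => g (expR s)) (fun s => expR (- (q * s)))).
  by apply: continuous_comp; [exact: continuous_expR|exact: cg].
apply: continuous_comp; last exact: continuous_expR.
by apply: continuousN; apply: continuousM; [exact: cst_continuous|exact: cvg_id].
Qed.

Definition lcos b : R -> R := fun t => 1 - cos (b * t).

Lemma continuous_lcos b : continuous (lcos b).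
Proof.
move=> t; rewrite /lcos; apply: cvgB; first exact: cvg_cst.
apply: continuous_comp; last exact: continuous_cos.
by apply: continuousM; [exact: cst_continuous|exact: cvg_id].
Qed.

Lemma lcos_ge0 b t : 0 <= lcos b t.
Proof. by rewrite subr_ge0 cos_le1. Qed.

Lemma log_weight_ge0 q g s : (forall t, 0 <= g t) -> 0 <= log_weight q g s.
Proof. by move=> g0; rewrite mulr_ge0 ?expR_ge0. Qed.

(** The weight decays at rate [q] for [s >= 0], where 1 - cos is bounded, and at rate [2 - q] for
    [s < 0], where it is quadratically small; [l] is the smaller rate. *)
Lemma integrable_lcos q b : 0 < q < 2 ->
  mu.-integrable setT (EFin \o log_weight q (lcos b)).
Proof.
move=> /andP[q0 q2]; pose l := Num.min q (2 - q).
have l0 : 0 < l by rewrite lt_min q0 subr_gt0.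
have lq : l <= q by rewrite ge_min lexx.
have lq2 : l <= 2 - q by rewrite ge_min lexx orbT.
apply: (@le_integrable _ _ _ mu _ _ _
  (EFin \o (fun s => (2 + b ^+ 2) * expR (- (l * `|s|))))) => //.
- apply/measurable_EFinP; apply: continuous_measurable_fun.
  by apply: continuous_log_weight; exact: continuous_lcos.
- move=> s _; rewrite /= lee_fin ger0_norm; last first.
    by apply: log_weight_ge0 => t; exact: lcos_ge0.
  have b2 := sqr_ge0 b.
  rewrite ger0_norm ?mulr_ge0 ?expR_ge0//; last by rewrite addr_ge0.
  rewrite /log_weight; have [s0|s0] := leP 0 s.
    apply: ler_pM; rewrite ?lcos_ge0 ?expR_ge0//.
      rewrite /lcos; have := cos_geN1 (b * expR s); nra.
    by rewrite ger0_norm// ler_expR lerN2 ler_wpM2r.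
  apply: (@le_trans _ _ ((b * expR s) ^+ 2 * expR (- (q * s)))).
    by rewrite ler_wpM2r ?expR_ge0// onem_cos_le_sqr.
  rewrite exprMn -mulrA; apply: ler_pM; rewrite ??sqr_ge0 ?(mulr_ge0 (sqr_ge0 _)) ?expR_ge0//.
    by lra.
  rewrite -expRM_natl -expRD ler_expR ltr0_norm// -mulr_natl; nra.
- have := @integrableZl _ _ _ mu setT measurableT (2 + b ^+ 2) _ (integrable_expRN_norm l0).
  by apply: eq_integrable => // s _; rewrite /= EFinM.
Qed.

Definition Rmom q g : R := (\int[mu]_s log_weight q g s)%R.

Lemma log_weight_lcosM q b c s : 0 < b ->
  log_weight q (lcos (b * c)) s = b `^ q * log_weight q (lcos c) (s + ln b).
Proof.
move=> b0; rewrite /log_weight /lcos expRD lnK ?posrE// mulrDr opprD expRD.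
rewrite /powR gt_eqF//.
have -> : expR (q * ln b) * ((1 - cos (c * (expR s * b))) *
    (expR (- (q * s)) * expR (- (q * ln b)))) =
  (expR (q * ln b) * expR (- (q * ln b))) * ((1 - cos (c * (expR s * b))) *
    (expR (- (q * s)))) by ring.
by rewrite -expRD subrr expR0 mul1r; congr ((1 - cos _) * _); ring.
Qed.

Lemma integral_shift g c : continuous g -> (forall s, 0 <= g s) ->
  (\int[mu]_s (g (s + c))%:E = \int[mu]_s (g s)%:E)%E.
Proof.
move=> cg g0.
have dE : (fun s : R => s + c)^`() = cst 1.
  by apply/funext => s; rewrite derive1E deriveD// derive_id derive_cst addr0.
rewrite (@increasing_ge0_integration_by_substitutionT _ (fun s => s + c) g)//.
- apply: eq_integral => s _; congr EFin.
  by rewrite [LHS]/= dE /= fctE mulr1.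
- by move=> x y; rewrite ltrD2r.
- by rewrite dE; exact: cst_continuous.
- by rewrite dE; exact: is_cvg_cst.
- by rewrite dE; exact: is_cvg_cst.
- by apply: cvg_addrr_Ny.
- by apply: cvg_addrr.
Qed.

Lemma lcos_norm b : lcos `|b| = lcos b.
Proof.
apply/funext => t; rewrite /lcos -[cos (b * t)]cos_norm normrM.
by rewrite -[cos (`|b| * t)]cos_norm normrM normr_id.
Qed.

(** For [b != 0], scaling by |b| translates [s] by ln |b|; the integral is invariant under this, and
    only the factor |b|^q remains. *)
Lemma Rmom_lcos q b : 0 < q < 2 -> Rmom q (lcos b) = `|b| `^ q * Rmom q (lcos 1).
Proof.
move=> q02; have [->|b0] := eqVneq b 0.
  rewrite normr0 powR0 ?mul0r; last by case/andP: q02 => /gt_eqF ->.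
  rewrite /Rmom (_ : log_weight q (lcos 0) = cst 0); first by rewrite Rintegral_cst ?mul0r.
  by apply/funext => s; rewrite /log_weight /lcos mul0r cos0 subrr mul0r.
rewrite -lcos_norm; set c := `|b|; have c0 : 0 < c by rewrite normr_gt0.
rewrite /Rmom; under eq_Rintegral do rewrite -[c]mulr1 log_weight_lcosM//.
have cw := @continuous_log_weight q _ (@continuous_lcos 1).
have w0 s : 0 <= log_weight q (lcos 1) s.
  by apply: log_weight_ge0 => t; exact: lcos_ge0.
have Esh := integral_shift (ln c) cw w0.
rewrite RintegralZl//; last first.
  apply/integrableP; split.
    apply/measurable_EFinP; apply: continuous_measurable_fun => s.
    apply: (@continuous_comp _ _ _ (fun s => s + ln c) _ s); last exact: cw.
    by apply: continuousD; [exact: cvg_id|exact: cst_continuous].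
  under eq_integral do rewrite /= ger0_norm//.
  rewrite Esh; have /integrableP[_] := integrable_lcos 1 q02.
  by under eq_integral do rewrite /= ger0_norm//.
by congr (_ * fine _).
Qed.

Lemma Rmom_lcos1_gt0 q : 0 < q < 2 -> 0 < Rmom q (lcos 1).
Proof.
move=> q02; have [q0 q2] := andP q02.
have c1 : cos (1 : R) < 1.
  rewrite -[ltRHS]cos0 ltr_cos ?in_itv/= ?lexx ?pi_ge0 ?ler01 ?ltr01//.
  by rewrite (le_trans _ (pi_ge2 R))// ler1n.
have l2 : 0 < ln (2 : R) by rewrite ln_gt0// ltr1n.
(* For [s] in [0, ln 2] the argument [expR s] lies in [1, 2], where cosine decreases since
   [2 <= pi]; so [m] bounds the weight from below there. *)
pose m : R := (1 - cos 1) * expR (- (q * ln 2)).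
have m0 : 0 < m by rewrite mulr_gt0 ?expR_gt0 ?subr_gt0.
have w0 s : 0 <= log_weight q (lcos 1) s.
  by apply: log_weight_ge0 => t; exact: lcos_ge0.
have iw := integrable_lcos 1 q02.
have mw := measurable_int _ iw.
rewrite /Rmom -lte_fin fineK; last exact: integrable_fin_num.
apply: (@lt_le_trans _ _ (m * ln 2)%:E); first by rewrite lte_fin mulr_gt0.
apply: (@le_trans _ _ (\int[mu]_(s in `[0%R, ln 2]) (log_weight q (lcos 1) s)%:E)%E).
  have <- : (\int[mu]_(s in `[0%R, ln 2]) (cst m%:E) s = (m * ln 2)%:E)%E.
    rewrite integral_cst//= lebesgue_measure_itv/= lte_fin l2 EFinM.
    by rewrite oppr0 adde0.
  apply: ge0_le_integral => //=.
  - by move=> s _; rewrite lee_fin ltW.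
  - exact: measurable_funTS mw.
  - move=> s; rewrite in_itv/= => /andP[s0 s2]; rewrite lee_fin.
    have e1 : 1 <= expR s by rewrite -expR0 ler_expR.
    have e2 : expR s <= 2 by rewrite -(@lnK _ (2:R)) ?posrE ?ltr0n// ler_expR.
    apply: ler_pM; rewrite ?subr_ge0 ?cos_le1 ?expR_ge0//; last first.
      by rewrite ler_expR lerN2 ler_pM2l.
    have i1 : (1 : R) \in `[0, pi]%R.
      by rewrite in_itv/= ler01 (le_trans _ (pi_ge2 R))// ler1n.
    have i2 : expR s \in `[0, pi]%R.
      by rewrite in_itv/= (le_trans e2 (pi_ge2 R)) andbT (le_trans _ e1).
    by rewrite /lcos !mul1r lerD2l lerN2 leNgt ltr_cos// -leNgt.
apply: ge0_subset_integral => //.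
by move=> s _; rewrite lee_fin.
Qed.

(* [v] is the value at [g] of the positive linear functional that sends
   [1 - cos (b t)] to [|b| `^ q]. *)
Definition has_mom q g v :=
  mu.-integrable setT (EFin \o log_weight q g) /\ Rmom q g = v * Rmom q (lcos 1).

Lemma has_mom_lcos q b : 0 < q < 2 -> has_mom q (lcos b) (`|b| `^ q).
Proof. by move=> q02; split; [exact: integrable_lcos|exact: Rmom_lcos]. Qed.

Lemma has_momZ q g v c : has_mom q g v -> has_mom q (fun t => c * g t) (c * v).
Proof.
have E : log_weight q (fun t => c * g t) = (fun s => c * log_weight q g s).
  by apply/funext => s; rewrite /log_weight mulrA.
move=> [ig Ig]; split; rewrite ?/Rmom E.
  by have := integrableZl measurableT c ig; apply: eq_integrable => // s _; rewrite /= EFinM.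
by rewrite RintegralZl// -mulrA -Ig.
Qed.

Lemma has_momD q g g' v v' : has_mom q g v -> has_mom q g' v' ->
  has_mom q (fun t => g t + g' t) (v + v').
Proof.
have E : log_weight q (fun t => g t + g' t) = (fun s => log_weight q g s + log_weight q g' s).
  by apply/funext => s; rewrite /log_weight mulrDl.
move=> [ig Ig] [ig' Ig']; split; rewrite ?/Rmom E.
  by have := integrableD measurableT ig ig'; apply: eq_integrable => // s _; rewrite /= EFinD.
by rewrite RintegralD// mulrDl -Ig -Ig'.
Qed.

Lemma has_mom_sum q (I : Type) (r : seq I) (P : pred I) (g : I -> R -> R) (v : I -> R) :
  (forall i, has_mom q (g i) (v i)) ->
  has_mom q (fun t => \sum_(i <- r | P i) g i t) (\sum_(i <- r | P i) v i).
Proof.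
move=> H; elim: r => [|i r IHr].
  have E : log_weight q (fun t => \sum_(i <- [::] | P i) g i t) = cst 0.
    by apply/funext => s; rewrite /log_weight big_nil mul0r.
  rewrite big_nil; split; rewrite ?/Rmom E; last by rewrite Rintegral_cst// !mul0r.
  exact: integrable0.
rewrite big_cons (_ : (fun t => _) =
  (fun t => (if P i then g i t else 0) + \sum_(i <- r | P i) g i t)); last first.
  by apply/funext => t; rewrite big_cons; case: (P i); rewrite ?add0r.
case: (P i); first exact: has_momD.
by under [X in has_mom _ X _]funext => t do rewrite add0r.
Qed.

(** The passage from trigonometric inequalities, pointwise in [t], to inequalities between
    powers. *)
Lemma has_mom_le q g g' v v' : 0 < q < 2 -> has_mom q g v -> has_mom q g' v' ->
  (forall t, g t <= g' t) -> v <= v'.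
Proof.
move=> q02 [ig Ig] [ig' Ig'] gg'.
rewrite -(ler_pM2r (Rmom_lcos1_gt0 q02)) -Ig -Ig'; apply: le_Rintegral => // s _.
by rewrite ler_wpM2r ?expR_ge0.
Qed.

End Levy.

(** * Inequalities for the powers of pair and subset sums *)

Section PairSums.
Variable R : realType.

Lemma sqr_sum_le (I : finType) (c : I -> R) :
  (\sum_i c i) ^+ 2 <= #|I|%:R * \sum_i c i ^+ 2.
Proof.
have : 0 <= \sum_i \sum_j (c i - c j) ^+ 2.
  by apply: sumr_ge0 => i _; apply: sumr_ge0 => j _; exact: sqr_ge0.
have -> : \sum_i \sum_j (c i - c j) ^+ 2 =
    (#|I|%:R * \sum_i c i ^+ 2 - (\sum_i c i) ^+ 2) *+ 2.
  under eq_bigr => i _.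
    under eq_bigr => j _ do rewrite sqrrB addrAC.
    rewrite sumrB big_split/= sumr_const sumrMnl -mulr_sumr.
    over.
  rewrite sumrB big_split/= sumr_const !sumrMnl -mulr_suml -expr2.
  by rewrite -mulr_natl; ring.
by rewrite pmulrn_lge0// subr_ge0.
Qed.

(** With [n = #|I|], the right side is n^2 - (sum cos)^2 + (sum sin)^2 and the left side n^2 - n
    (sum cos^2); Cauchy-Schwarz compares them. *)
Lemma pair_cos_le (I : finType) (u : I -> R) :
  #|I|%:R / 2 * \sum_i (1 - cos (2 * u i)) <= \sum_i \sum_j (1 - cos (u i + u j)).
Proof.
have -> : \sum_i \sum_j (1 - cos (u i + u j)) =
    #|I|%:R ^+ 2 - (\sum_i cos (u i)) ^+ 2 + (\sum_i sin (u i)) ^+ 2.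
  under eq_bigr => i _.
    under eq_bigr => j _ do rewrite cosD opprB addrA.
    rewrite sumrB big_split/= sumr_const -!mulr_sumr.
    over.
  rewrite sumrB big_split/= sumr_const -!mulr_suml -[1 *+ _ *+ _]mulr_natl.
  by ring.
have -> : \sum_i (1 - cos (2 * u i)) = 2 * (#|I|%:R - \sum_i cos (u i) ^+ 2).
  rewrite mulrBr mulr_sumr -[#|I|%:R]sumr_const mulr_sumr -sumrB.
  apply: eq_bigr => i _; rewrite mulr_natl cos_mulr2n -mulr_natl; ring.
have := sqr_sum_le (fun i => cos (u i)); have := sqr_ge0 (\sum_i sin (u i)).
have h : #|I|%:R / 2 * (2 * (#|I|%:R - \sum_i cos (u i) ^+ 2)) =
   #|I|%:R ^+ 2 - #|I|%:R * \sum_i cos (u i) ^+ 2 by field.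
rewrite h; lra.
Qed.

Lemma pair_powR_le (I : finType) (a : I -> R) (q : R) : 0 < q <= 2 ->
  #|I|%:R / 2 * \sum_i `|2 * a i| `^ q <= \sum_i \sum_j `|a i + a j| `^ q.
Proof.
(* The moment integral diverges for [q = 2]; there the two sides differ by 2 (sum a_i)^2. *)
move=> /andP[q0]; rewrite le_eqVlt => /predU1P[->|q2].
  have E x : `|x : R| `^ 2 = x ^+ 2 by rewrite powR_mulrn// real_normK ?num_real.
  under eq_bigr do rewrite E exprMn.
  rewrite -mulr_sumr.
  under [leRHS]eq_bigr => i _.
    under eq_bigr => j _ do rewrite E sqrrD addrAC -mulr_natl.
    rewrite !big_split/= sumr_const -!mulr_sumr.
    over.
  rewrite !big_split/= sumr_const sumrMnl -mulr_sumr -mulr_suml -expr2.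
  have := sqr_ge0 (\sum_i a i); rewrite -[_ *+ #|I|]mulr_natl.
  set S := \sum_i a i ^+ 2; lra.
have q02 : 0 < q < 2 by rewrite q0.
apply: (has_mom_le q02
  (has_momZ (#|I|%:R / 2) (has_mom_sum _ _ (fun i => has_mom_lcos (2 * a i) q02)))
  (has_mom_sum _ _ (fun i => has_mom_sum _ _ (fun j => has_mom_lcos (a i + a j) q02)))).
move=> t; rewrite /lcos.
have := pair_cos_le (fun i => a i * t).
under eq_bigr do rewrite mulrA.
by under [leRHS]eq_bigr do under eq_bigr do rewrite -mulrDl.
Qed.

End PairSums.

Section SubsetSums.
Variable R : realType.
Implicit Types (q b : R).

(** The average of [N] over [b] plus the sums of all subsequences of [s]; in the recursion, each
    element costs one use of the cosine addition formulas. *)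
Fixpoint subset_avg (V : zmodType) (N : V -> R) (b : V) (s : seq V) : R :=
  if s is a :: s' then (subset_avg N b s' + subset_avg N (b + a) s') / 2 else N b.

(** Induction by cos (A - h) + cos (A + h) = 2 cos A cos h, where h is half the phase of the new
    element. *)
Lemma has_mom_subset_avg q b (s : seq R) : 0 < q < 2 ->
  has_mom q (fun t => 1 - cos (b * t + \sum_(a <- s) a * t / 2) *
                          \prod_(a <- s) cos (a * t / 2))
    (subset_avg (fun x => `|x| `^ q) b s).
Proof.
move=> q02; elim: s b => [|a s IHs] b /=.
  under [X in has_mom _ X _]funext => t do rewrite !big_nil addr0 mulr1.
  exact: has_mom_lcos.
rewrite mulrC; have := has_momZ 2^-1 (has_momD (IHs b) (IHs (b + a))).
congr (has_mom _ _ _); apply/funext => t; rewrite !big_cons.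
set S := \sum_(a <- s) _; set P := \prod_(a <- s) _.
have -> : (b + a) * t + S = (b * t + (a * t / 2 + S)) + a * t / 2 by field.
have -> : b * t + S = (b * t + (a * t / 2 + S)) - (a * t / 2) by field.
by rewrite cosB [cos (_ + _ + _ / 2)]cosD; field.
Qed.

Lemma subset_avg_le1 (V : zmodType) (N : V -> R) (b : V) (s : seq V) :
  (forall m, N (b + \sum_(a <- mask m s) a) <= 1) -> subset_avg N b s <= 1.
Proof.
elim: s b => [|a s IHs] b H /=; first by have := H [::]; rewrite big_nil addr0.
have h1 : subset_avg N b s <= 1 by apply: IHs => m; have := H (false :: m).
have h2 : subset_avg N (b + a) s <= 1.
  by apply: IHs => m; have := H (true :: m); rewrite /= big_cons addrA.
lra.
Qed.

(** Strictness comes from the empty sum. *)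
Lemma subset_avg_lt1 (V : zmodType) (N : V -> R) (s : seq V) : N 0 < 1 ->
  (forall m, N (\sum_(a <- mask m s) a) <= 1) -> subset_avg N 0 s < 1.
Proof.
move=> N0; elim: s => [|a s IHs] H //=.
have h1 : subset_avg N 0 s < 1 by apply: IHs => m; have := H (false :: m).
have h2 : subset_avg N (0 + a) s <= 1.
  by apply: subset_avg_le1 => m; have := H (true :: m); rewrite /= big_cons add0r.
lra.
Qed.

(** Fourier expansion, with coefficients 2 C(6, k) / 2^6 for k = 2, 1, 0. *)
Lemma onem_cos6 (x : R) : 1 - cos (x / 2) ^+ 6 =
  15 / 32 * (1 - cos x) + 6 / 32 * (1 - cos (2 * x)) + 1 / 32 * (1 - cos (3 * x)).
Proof.
have E2 y : cos (2 * y) = 2 * cos y ^+ 2 - 1 :> R.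
  by rewrite mulr_natl cos_mulr2n mulr_natl.
have -> : 3 * x = 2 * x + x by ring.
rewrite cosD {1}(_ : x = 2 * (x / 2)); last by field.
rewrite (_ : sin (2 * x) * sin x = 2 * (1 - cos x ^+ 2) * cos x); last first.
  by rewrite mulr_natl sin_mulr2n -mulr_natl -sin2cos2; ring.
rewrite !E2 mulrCA mulfV ?mulr1//.
have -> : cos x = 2 * cos (x / 2) ^+ 2 - 1 by rewrite -E2; congr cos; field.
by field.
Qed.

(** Likewise with 2 C(8, k) / 2^8 for k = 3, 2, 1, 0, derived from [onem_cos6] by cos^8 (x / 2) =
    cos^6 (x / 2) (cos x + 1) / 2. *)
Lemma onem_cos8 (x : R) : 1 - cos (x / 2) ^+ 8 =
  56 / 128 * (1 - cos x) + 28 / 128 * (1 - cos (2 * x)) +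
  8 / 128 * (1 - cos (3 * x)) + 1 / 128 * (1 - cos (4 * x)).
Proof.
have E2 y : cos (2 * y) = 2 * cos y ^+ 2 - 1 :> R.
  by rewrite mulr_natl cos_mulr2n mulr_natl.
have E8 : cos (x / 2) ^+ 8 = cos (x / 2) ^+ 6 * ((cos x + 1) / 2).
  have -> : cos x = 2 * cos (x / 2) ^+ 2 - 1 by rewrite -E2; congr cos; field.
  by field.
have := onem_cos6 x; rewrite E8 (_ : 4 * x = 2 * (2 * x)); last by ring.
have E3 : cos (3 * x) = 4 * cos x ^+ 3 - 3 * cos x.
  have -> : 3 * x = 2 * x + x by ring.
  by rewrite cosD E2 !mulr_natl sin_mulr2n -mulrnAl -mulrA -expr2 sin2cos2 -mulr_natl; ring.
move=> /(congr1 (fun z => 1 - z)); rewrite subKr => ->.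
by rewrite E3 !E2; field.
Qed.

Lemma norm_prod_le_mean (I : finType) (c : I -> R) : (0 < #|I|)%N ->
  `|\prod_i c i| <= (\sum_i `|c i| ^+ #|I|) / #|I|%:R.
Proof.
move=> n0; have nR : 0 < #|I|%:R :> R by rewrite ltr0n.
have s0 : 0 <= (\sum_i `|c i| ^+ #|I|) / #|I|%:R.
  by rewrite divr_ge0 ?sumr_ge0 ?ltW// => i _; rewrite exprn_ge0.
rewrite -(@ler_pXn2r _ #|I|) ?nnegrE// normr_prod -prodrXl.
have [] := @leif_AGM R I predT (fun i => `|c i| ^+ #|I|).
  by move=> i _; rewrite exprn_ge0.
by [].
Qed.

(** The [q]-th power of the l_q norm: for [q > 0], conditions comparing the norm with 1 carry over
    without roots. *)
Definition powsum (q : R) (d : nat) (x : 'rV[R]_d) : R := \sum_j `|x ord0 j| `^ q.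

Lemma subset_avg_powsum q d (b : 'rV[R]_d) (s : seq 'rV[R]_d) :
  subset_avg (powsum q (d:=d)) b s =
  \sum_j subset_avg (fun x => `|x| `^ q) (b ord0 j) [seq x ord0 j | x : 'rV[R]_d <- s].
Proof.
elim: s b => [|a s IHs] b //=.
rewrite !IHs -big_split/= mulr_suml; apply: eq_bigr => j _.
by rewrite mxE.
Qed.

(** The function [h] replaces 1 - |cos|^n by something of computable moment. In each coordinate, the
    arithmetic-geometric mean inequality puts the mean of [h] over [i] below the integrand of
    [has_mom_subset_avg]. Taking moments and summing over the coordinates bounds [k] by the average
    over all subset sums, which is less than 1. *)
Lemma subset_sums_moment (d : nat) q (I : finType) (x : I -> 'rV[R]_d)
    (h : R -> R) (k : R) : 0 < q < 2 -> (0 < #|I|)%N ->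
  (forall y, h y <= 1 - `|cos (y / 2)| ^+ #|I|) ->
  (forall a, has_mom q (fun t => h (a * t)) (`|a| `^ q * k)) ->
  (forall i, powsum q (x i) = 1) ->
  (forall J : {set I}, powsum q (\sum_(i in J) x i) <= 1) ->
  k < 1.
Proof.
move=> q02 n0 hle hmom x1 xJ; have nR : 0 < #|I|%:R :> R by rewrite ltr0n.
have q0 : q != 0 by case/andP: q02 => /gt_eqF ->.
pose s := [seq x i | i <- enum I].
have : subset_avg (powsum q (d:=d)) 0 s < 1.
  apply: subset_avg_lt1 => [|m].
    rewrite /powsum big1 ?ltr01// => j _.
    by rewrite mxE normr0 powR0.
  rewrite /s -map_mask big_map; set r := mask m _.
  have ur : uniq r by rewrite mask_uniq// enum_uniq.
  have := xJ [set i in r]; rewrite big_uniq//=; congr (powsum _ _ <= _).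
  by apply: eq_bigl => i; rewrite inE.
apply: le_lt_trans; rewrite subset_avg_powsum.
have -> : k = \sum_j #|I|%:R^-1 * \sum_i `|x i ord0 j| `^ q * k.
  rewrite -mulr_sumr exchange_big/=.
  under eq_bigr => i _ do rewrite -mulr_suml -/(powsum q (x i)) x1 mul1r.
  by rewrite sumr_const -[k *+ #|I|]mulr_natl mulKf// gt_eqF.
apply: ler_sum => j _; rewrite mxE.
apply: (has_mom_le q02
  (has_momZ #|I|%:R^-1 (has_mom_sum _ _ (fun i => hmom (x i ord0 j))))
  (has_mom_subset_avg _ _ q02)) => t.
rewrite /s -map_comp !big_map -enumT !big_enum/= mul0r add0r.
set S := (X in cos X * _).
have := norm_prod_le_mean (fun i => cos (x i ord0 j * t / 2)) n0.
set P := \prod_i _ => hP.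
have h1 : cos S * P <= `|P|.
  by rewrite (le_trans (ler_norm _))// normrM ler_piMl// cos_max.
apply: (@le_trans _ _ (1 - `|P|)); last by rewrite lerD2l lerN2.
apply: (@le_trans _ _ (#|I|%:R^-1 *
   \sum_i (1 - `|cos (x i ord0 j * t / 2)| ^+ #|I|))).
  by rewrite ler_pM2l ?invr_gt0//; apply: ler_sum => i _.
rewrite sumrB sumr_const mulrBr mulVf ?gt_eqF// lerD2l lerN2 mulrC.
by rewrite mulrC in hP *.
Qed.

End SubsetSums.

(** * Bounds on the number of unit vectors with small subset sums *)

Section DualBounds.
Variables (R : realType) (d : nat) (q : R) (I : finType) (x : I -> 'rV[R]_d).
Hypothesis x1 : forall i, powsum q (x i) = 1.
Hypothesis xJ : forall J : {set I}, powsum q (\sum_(i in J) x i) <= 1.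

Lemma powR_natMl (n : nat) (a : R) : `|n%:R * a| `^ q = n%:R `^ q * `|a| `^ q.
Proof. by rewrite normrM normr_nat powRM. Qed.

(** [pair_powR_le] summed over the coordinates: each of the n diagonal pairs contributes 2^q, each
    of the n (n - 1) others at most 1 by [xJ]; then n is cancelled. *)
Lemma powsum_pairs_le : 0 < q <= 2 -> (0 < #|I|)%N ->
  #|I|%:R / 2 * 2 `^ q <= #|I|%:R - 1 + 2 `^ q.
Proof.
move=> q02 n0; have nR : 0 < #|I|%:R :> R by rewrite ltr0n.
have H j : #|I|%:R / 2 * \sum_i `|2 * x i ord0 j| `^ q <=
   \sum_i \sum_i' `|x i ord0 j + x i' ord0 j| `^ q by exact: pair_powR_le.
have L : \sum_j (#|I|%:R / 2 * \sum_i `|2 * x i ord0 j| `^ q) =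
    #|I|%:R * (#|I|%:R / 2 * 2 `^ q).
  rewrite -mulr_sumr exchange_big/=.
  have E i : \sum_j `|2 * x i ord0 j| `^ q = 2 `^ q.
    under eq_bigr do rewrite powR_natMl.
    by rewrite -mulr_sumr -/(powsum q (x i)) x1 mulr1.
  under eq_bigr do rewrite E.
  by rewrite sumr_const -[_ *+ #|I|]mulr_natl; ring.
rewrite -(ler_pM2l nR) -L; apply: le_trans (ler_sum _ (fun j _ => H j)) _.
rewrite exchange_big/= [leRHS]mulr_natl -sumr_const.
apply: ler_sum => i _; rewrite exchange_big/= (bigD1 i)//= addrC.
apply: lerD; last first.
  have <- : \sum_j `|2 * x i ord0 j| `^ q = 2 `^ q.
    under eq_bigr do rewrite powR_natMl.
    by rewrite -mulr_sumr -/(powsum q (x i)) x1 mulr1.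
  by rewrite le_eqVlt; apply/predU1P; left; apply: eq_bigr => j _; rewrite mulr_natl.
apply: (@le_trans _ _ (\sum_(i' | i' != i) 1)).
  apply: ler_sum => i' i'i; have := xJ [set i; i'].
  rewrite big_setU1 ?big_set1/=; last by rewrite inE eq_sym.
  by apply: le_trans; apply: ler_sum => j _; rewrite mxE.
by rewrite sumr_const (cardC1 i) -subn1 natrB.
Qed.

Lemma card4_powR2_le : 0 < q <= 2 -> #|I| = 4%N -> 2 `^ q <= 3 :> R.
Proof. by move=> q02 I4; have := powsum_pairs_le q02; rewrite I4 => /(_ isT); lra. Qed.

Lemma card5_powR2_le : 0 < q <= 2 -> #|I| = 5%N -> 2 `^ q <= 8 / 3 :> R.
Proof. by move=> q02 I5; have := powsum_pairs_le q02; rewrite I5 => /(_ isT); lra. Qed.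

(** [k6] and [k8] are the moments of 1 - cos^6 (t / 2) and 1 - cos^8 (t / 2), in units of that of 1
    - cos t. *)
Let k6 : R := (15 + 6 * 2 `^ q + 3 `^ q) / 32.
Let k8 : R := (56 + 28 * 2 `^ q + 8 * 3 `^ q + 4 `^ q) / 128.

Lemma has_mom_cos6 a : 0 < q < 2 ->
  has_mom q (fun t => 1 - cos (a * t / 2) ^+ 6) (`|a| `^ q * k6).
Proof.
move=> q02.
have := has_momD (has_momD (has_momZ (15 / 32) (has_mom_lcos a q02))
  (has_momZ (6 / 32) (has_mom_lcos (2 * a) q02)))
  (has_momZ (1 / 32) (has_mom_lcos (3 * a) q02)).
rewrite !powR_natMl; congr has_mom; last by rewrite /k6; field.
by apply/funext => t; rewrite onem_cos6 /lcos !mulrA.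
Qed.

Lemma has_mom_cos8 a : 0 < q < 2 ->
  has_mom q (fun t => 1 - cos (a * t / 2) ^+ 8) (`|a| `^ q * k8).
Proof.
move=> q02.
have := has_momD (has_momD (has_momD (has_momZ (56 / 128) (has_mom_lcos a q02))
  (has_momZ (28 / 128) (has_mom_lcos (2 * a) q02)))
  (has_momZ (8 / 128) (has_mom_lcos (3 * a) q02)))
  (has_momZ (1 / 128) (has_mom_lcos (4 * a) q02)).
rewrite !powR_natMl; congr has_mom; last by rewrite /k8; field.
by apply/funext => t; rewrite onem_cos8 /lcos !mulrA.
Qed.

(** [k6 < 1] reads 6 2^q + 3^q < 17. If 3^q > 4, then 2^q < 13/6, which is too small compared with
    3^q. *)
Lemma card6_powR3_le : 1 <= q < 2 -> #|I| = 6%N -> 3 `^ q <= 4 :> R.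
Proof.
move=> /andP[q1 q2] I6; have q02 : 0 < q < 2 by rewrite (lt_le_trans ltr01 q1).
have : k6 < 1.
  apply: (subset_sums_moment q02 (h := fun y => 1 - cos (y / 2) ^+ 6) _ _
    (fun a => has_mom_cos6 a q02) x1 xJ).
    by rewrite I6.
  by move=> y; rewrite I6 lerD2l lerN2 -normrX ger0_norm ?lexx// exprn_even_ge0.
rewrite leNgt /k6 => k1; apply/negP => h.
(* [27 <= 32] gives [4 ^ 3 < (3 `^ q) ^ 3 <= (2 `^ q) ^ 5] *)
have h5 : (3 `^ q) ^+ 3 <= (2 `^ q) ^+ 5 :> R.
  rewrite -!powR_mulrn ?powR_ge0// -!powRrM ![q * _]mulrC !powRrM !powR_mulrn//.
  apply: ge0_ler_powR; rewrite ?nnegrE ?exprn_ge0 ?(le_trans ler01 q1)//.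
  by rewrite -!natrX ler_nat.
have h2 : 2 `^ q < 13 / 6 :> R by lra.
have : (2 `^ q) ^+ 5 < (13 / 6) ^+ 5 :> R by rewrite ltr_pXn2r// nnegrE ?powR_ge0.
have : 4 ^+ 3 < (3 `^ q) ^+ 3 :> R by rewrite ltr_pXn2r// nnegrE ?powR_ge0.
have : (13 / 6) ^+ 5 <= 4 ^+ 3 :> R by lra.
lra.
Qed.

(** The odd power |c|^7 is bounded by (c^6 + c^8) / 2, whose expansion is known; the resulting
    moment is at least 65/64 for [q >= 1]. *)
Lemma card_neq7 : 1 <= q < 2 -> #|I| <> 7%N.
Proof.
move=> /andP[q1 q2] I7; have q02 : 0 < q < 2 by rewrite (lt_le_trans ltr01 q1).
have : 2^-1 * (k6 + k8) < 1.
  have hm a := has_momZ 2^-1 (has_momD (has_mom_cos6 a q02) (has_mom_cos8 a q02)).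
  apply: (subset_sums_moment q02 (h := fun y => 2^-1 * ((1 - cos (y / 2) ^+ 6) +
    (1 - cos (y / 2) ^+ 8))) _ _ _ x1 xJ).
  - by rewrite I7.
  - move=> y; rewrite I7; set c := cos _.
    have -> : c ^+ 6 = `|c| ^+ 6 by rewrite -normrX ger0_norm// exprn_even_ge0.
    have -> : c ^+ 8 = `|c| ^+ 8 by rewrite -normrX ger0_norm// exprn_even_ge0.
    rewrite -subr_ge0.
    have -> : 1 - `|c| ^+ 7 - 2^-1 * (1 - `|c| ^+ 6 + (1 - `|c| ^+ 8)) =
       2^-1 * (`|c| ^+ 3 * (1 - `|c|)) ^+ 2 by field.
    by rewrite mulr_ge0 ?sqr_ge0 ?invr_ge0.
  - by move=> a; have := hm a; congr has_mom; rewrite -mulrDr mulrCA.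
have p n : (0 < n)%N -> n%:R <= n%:R `^ q :> R by move=> n0; rewrite le1r_powR// ler1n.
have := p 2 isT; have := p 3 isT; have := p 4 isT.
rewrite /k6 /k8; lra.
Qed.

End DualBounds.

(** * Spanning trees and calibrations *)

Section ParentTrees.
Variable T : finType.
Implicit Types (e : rel T) (r v w : T) (p : T -> T) (h : T -> nat).

(** [h v] is the distance from [r], and [p v] the last vertex but one on a shortest path from [r] to
    [v]. *)
Lemma connect_parent e r : (forall v, connect e r v) ->
  exists p h, [/\ p r = r & forall v, v != r -> e (p v) v /\ (h (p v) < h v)%N].
Proof.
move=> er.
pose P v n := [exists s : n.-tuple T, path e r s && (last r s == v)].
have exP v : exists n, P v n.
  have /connectP[s es ->] := er v.
  by exists (size s); apply/existsP; exists (in_tuple s); rewrite es /= eqxx.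
pose h v := ex_minn (exP v).
have step v : exists u, (v = r -> u = r) /\
    (v != r -> e u v /\ (h u < h v)%N).
  have [->|vr] := eqVneq v r; first by exists r; split.
  have : P v (h v) by rewrite /h; case: ex_minnP.
  case/existsP => -[s /= /eqP sz] /andP[].
  case/lastP: s sz => [|s u] sz; first by move=> _ /= /eqP vE; rewrite vE eqxx in vr.
  rewrite rcons_path last_rcons => /andP[es eu] /eqP uv; subst u.
  exists (last r s); split=> [E|_]; first by rewrite E eqxx in vr.
  split=> //; rewrite -sz size_rcons ltnS [h (last r s)]/h.
  case: ex_minnP => n _; apply.
  by apply/existsP; exists (in_tuple s); rewrite /= es eqxx.
have [p Hp] := choice step.
exists p, h; split; first by case: (Hp r) => ->.
by move=> v vr; case: (Hp v) => _; apply.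
Qed.

Definition parent_rel p r : rel T :=
  fun u v => (u != r) && (p u == v) || (v != r) && (p v == u).

(** Acyclicity: on a cycle of length at least 3, both neighbours of a vertex of maximal height would
    be its parent, yet they are distinct. *)
Lemma parent_tree p h r : (forall v, v != r -> (h (p v) < h v)%N) ->
  is_tree (parent_rel p r).
Proof.
move=> ph.
have sym : symmetric (parent_rel p r) by move=> u v; rewrite /parent_rel orbC.
have toR v : connect (parent_rel p r) v r.
  have [n] := ubnP (h v); elim: n v => // n IHn v.
  rewrite ltnS => hv; have [->|vr] := eqVneq v r; first exact: connect0.
  apply: (connect_trans (y := p v)); last by apply: IHn; exact: leq_trans (ph v vr) hv.
  by apply: connect1; rewrite /parent_rel vr eqxx.
split=> //.
- by apply/card_gt0P; exists r.
- by move=> u; rewrite /parent_rel orbb; apply/andP => -[/ph + /eqP E]; rewrite E ltnn.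
- move=> u v; apply: (connect_trans (toR u)).
  by rewrite (sym_connect_sym sym).
move=> c /andP[cc uc]; rewrite leqNgt; apply/negP => c3.
have [x0 x0c] : exists x0, x0 \in c.
  by case: c c3 {cc uc} => // a c; exists a; rewrite mem_head.
have [x xc xmax] := @arg_maxnP T x0 (mem c) h x0c.
have up y : y \in c -> parent_rel p r x y -> p x = y.
  move=> yc /orP[/andP[_ /eqP//]|/andP[/ph + /eqP E]].
  by have /= hyx := xmax y yc; rewrite E ltnNge hyx.
have [i c' Ec] := rot_to xc.
have sc' : size c = (size c').+1 by rewrite -(size_rot i) Ec.
have c'c y : y \in c' -> y \in c by move=> yc; rewrite -(mem_rot i) Ec inE yc orbT.
move: cc uc; rewrite -(rot_cycle i) -(rot_uniq i) Ec /= rcons_path.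
case: c' sc' c'c {Ec} => [|y [|z c']] sc' c'c; rewrite ?sc' // in c3 *.
move=> /andP[/= /andP[xy _] lx] /andP[_ /andP[yc _]].
have E1 := up y (c'c y (mem_head _ _)) xy.
have lc : last z c' \in z :: c' by exact: mem_last.
have E2 : p x = last z c'.
  by apply: up; [apply: c'c; rewrite inE lc orbT|rewrite sym].
by rewrite -E1 E2 lc in yc.
Qed.

Lemma spanning_tree e : (0 < #|T|)%N -> symmetric e -> (forall u v, connect e u v) ->
  exists e', is_tree e' /\ subrel e' e.
Proof.
move=> /card_gt0P[r _] sym con.
have [p [h [_ ph]]] := connect_parent (con r).
exists (parent_rel p r); split.
  by apply: (@parent_tree _ h) => v /ph[].
by move=> u v /orP[]/andP[/ph[] + _ /eqP E]; rewrite E ?(sym v u).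
Qed.

(** [L] may repeat pairs, so the length of a graph can be bounded from a list of edges without
    checking for coincidences. *)
Lemma sum_rel_seq_le (R : realDomainType) (L : seq (T * T)) (F : T -> T -> R) :
  (forall u v, 0 <= F u v) ->
  \sum_u \sum_(v | (u, v) \in L) F u v <= \sum_(uv <- L) F uv.1 uv.2.
Proof.
move=> F0; rewrite pair_big_dep/=.
elim: L => [|[a b] L IHL]; first by rewrite big_pred0// big_nil.
rewrite big_cons (bigD1 (a, b)) ?mem_head//=;
rewrite lerD2l; apply: le_trans IHL.
rewrite big_mkcond [leRHS]big_mkcond/=; apply: ler_sum => -[u v] _.
rewrite inE/=; case: eqVneq => [->|_] /=; first by case: ifP.
by rewrite andbT.
Qed.

End ParentTrees.

Section Calibration.
Variables (R : realType) (d : nat).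
Implicit Types (u v : 'rV[R]_d).

Definition dot u v : R := \sum_j u ord0 j * v ord0 j.

Lemma dot_sumr I (s : seq I) (P : pred I) u (F : I -> 'rV[R]_d) :
  dot u (\sum_(i <- s | P i) F i) = \sum_(i <- s | P i) dot u (F i).
Proof.
by rewrite exchange_big/=; apply: eq_bigr => j _; rewrite summxE mulr_sumr.
Qed.

Lemma dot_suml I (s : seq I) (P : pred I) u (F : I -> 'rV[R]_d) :
  dot (\sum_(i <- s | P i) F i) u = \sum_(i <- s | P i) dot (F i) u.
Proof.
by rewrite exchange_big/=; apply: eq_bigr => j _; rewrite summxE mulr_suml.
Qed.

Lemma dotBr u v w : dot u (v - w) = dot u v - dot u w.
Proof. by rewrite -sumrB; apply: eq_bigr => j _; rewrite !mxE mulrBr. Qed.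

Lemma dot0l v : dot 0 v = 0.
Proof. by rewrite /dot big1// => j _; rewrite mxE mul0r. Qed.

(* Each edge of the tree separates the labels into those below it and the
   others; the flow through the edge is the sum of the labels below. *)
Lemma calibration (T : finType) (e : rel T) (nrm : 'rV[R]_d -> R)
    (g pos : T -> 'rV[R]_d) :
  is_tree e -> (forall v, 0 <= nrm v) -> (forall v, nrm (- v) = nrm v) ->
  \sum_x g x = 0 ->
  (forall (A : {set T}) v, dot (\sum_(x in A) g x) v <= nrm v) ->
  \sum_x dot (g x) (pos x) <=
    (\sum_x \sum_(y | e x y) nrm (pos x - pos y)) / 2.
Proof.
move=> [/card_gt0P[r _] sym _ con _] nrm0 nrmN g0 gA.
have [p [h [pr ph]]] := connect_parent (con r).
have hp x : (h (p x) <= h x)%N.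
  by have [->|/ph[_ /ltnW]//] := eqVneq x r; rewrite pr.
have hanc x y : fconnect p x y -> (h y <= h x)%N.
  move=> /iter_findex <-; elim: (findex _ _ _) => //= n.
  exact: leq_trans (hp _).
(* [fconnect p x y] says that [y] is [x] or one of its ancestors. *)
have anc_step x y : fconnect p x y = (y == x) || fconnect p (p x) y.
  apply/idP/orP => [/iter_findex|[/eqP->|]].
  - case: (findex _ _ _) => [/= ->|n]; first by left.
    by rewrite iterSr => <-; right; exact: fconnect_iter.
  - exact: connect0.
  - exact/connect_trans/fconnect1.
have tele x : pos x - pos r = \sum_(y | (y != r) && fconnect p x y) (pos y - pos (p y)).
  have [n] := ubnP (h x); elim: n x => // n IHn x; rewrite ltnS => hx.
  have [->|xr] := eqVneq x r.
    rewrite subrr big_pred0// => y; apply/andP => -[yr /iter_findex].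
    by rewrite iter_fix// => ry; rewrite -ry eqxx in yr.
  rewrite (bigD1 x) ?xr ?connect0//= -(subrKA (pos (p x))); congr (_ + _).
  have [_ hpx] := ph x xr.
  rewrite IHn ?(leq_trans hpx)//; apply: eq_bigl => y; rewrite [in RHS]anc_step.
  have [->|yx] := eqVneq y x; last by rewrite /= andbT.
  rewrite andbF andbC; apply/negbTE/negP => /andP[/hanc].
  by rewrite leqNgt hpx.
(* Summation by parts: as the labels sum to zero, [pos r] can be subtracted; telescoping to the root
   and exchanging the sums collects the labels below each edge. *)
have -> : \sum_x dot (g x) (pos x) =
    \sum_(y | y != r) dot (\sum_(x in [set x | fconnect p x y]) g x) (pos y - pos (p y)).
  transitivity (\sum_x dot (g x) (pos x - pos r)).
    under [RHS]eq_bigr do rewrite dotBr.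
    by rewrite sumrB -[X in _ - X]dot_suml g0 dot0l subr0.
  under eq_bigr do rewrite tele dot_sumr.
  rewrite (exchange_big_dep (fun y => y != r))/=; last by move=> x y _ /andP[].
  apply: eq_bigr => y yr; rewrite dot_suml; apply: eq_bigl => x.
  by rewrite inE yr.
(* The right side sees each edge in both orders, so the sum over edges to parents is taken twice. *)
rewrite ler_pdivlMr// mulr_natr mulr2n.
set S := (X in X + _ <= _).
have SL : S <= \sum_(y | y != r) nrm (pos y - pos (p y)).
  by apply: ler_sum => y _; exact: gA.
apply: le_trans (lerD SL SL) _.
have E1 : \sum_(y | y != r) nrm (pos y - pos (p y)) =
    \sum_x \sum_y (if (x != r) && (p x == y) then nrm (pos x - pos y) else 0).
  rewrite big_mkcond; apply: eq_bigr => x _; case: (x != r) => /=; last by rewrite big1.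
  by rewrite -big_mkcond/= (eq_bigl (pred1 (p x))) ?big_pred1_eq// => y; rewrite eq_sym.
have E2 : \sum_(y | y != r) nrm (pos y - pos (p y)) =
    \sum_x \sum_y (if (y != r) && (p y == x) then nrm (pos x - pos y) else 0).
  rewrite exchange_big/= E1; apply: eq_bigr => x _; apply: eq_bigr => y _.
  by case: ifP => // _; rewrite -nrmN opprB.
rewrite {1}E1 E2 -big_split/=; apply: ler_sum => x _.
rewrite -big_split/= [leRHS]big_mkcond/=; apply: ler_sum => y _.
case: ifP => [/andP[xr /eqP pxy]|_]; last first.
  rewrite add0r; case: ifP => [/andP[yr /eqP pyx]|_]; last by case: ifP.
  by have [+ _] := ph y yr; rewrite pyx => ->.
have [+ hx] := ph x xr; rewrite pxy sym => ->.
(* Two vertices cannot be parents of each other, as [h] drops strictly. *)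
case: ifP => [/andP[yr /eqP pyx]|_]; last by rewrite addr0.
by have [_] := ph y yr; rewrite pyx ltnNge -pxy ltnW.
Qed.

End Calibration.

(** * Steiner minimal trees *)

Section SteinerTrees.
Variables (R : realType) (X : vectType R) (nrm : X -> R).
Hypothesis nrm_ge0 : forall v, 0 <= nrm v.
Hypothesis nrmN : forall v, nrm (- v) = nrm v.

Lemma SMT_le_connected (S V V' : {fset X}) (e : rel V) (e' : rel V') :
  is_SMT nrm S e -> (S `<=` V')%fset -> (0 < #|{: V'}|)%N -> symmetric e' ->
  (forall u v, connect e' u v) -> tree_length nrm e <= tree_length nrm e'.
Proof.
move=> [_ _ min] SV' n0 sym con; have [e'' [te se]] := spanning_tree n0 sym con.
apply: le_trans (min _ _ SV' te) _; rewrite ler_pM2r ?invr_gt0//.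
apply: ler_sum => u _; rewrite big_mkcond [leRHS]big_mkcond/=; apply: ler_sum => v _.
by case: ifP => [/se->//|_]; case: ifP.
Qed.

(* Competitor: the edges from [x] to [J] are replaced by edges from [z] to [J]
   together with an edge from [x] to [z]. *)
Lemma SMT_split_le (S V : {fset X}) (e : rel V) (x : V) (J : {set V}) (z : X) :
  is_SMT nrm S e -> (forall y, y \in J -> e x y) ->
  \sum_(y in J) nrm (val y - val x) <=
    nrm (z - val x) + \sum_(y in J) nrm (val y - z).
Proof.
move=> smt xJ; have [SV [_ sym irr con _] _] := smt.
pose V' := (z |` V)%fset.
have VV' : (V `<=` V')%fset by exact: fsubsetU1.
pose i : V -> V' := fincl VV'.
pose z' : V' := [` fset1U1 z V]%fset.
pose cut (c : V * V) := (c.1 == x) && (c.2 \in J) || (c.2 == x) && (c.1 \in J).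
pose L0 := [seq (i c.1, i c.2) | c <- enum [pred c : V * V | e c.1 c.2 && ~~ cut c]].
pose L1 := [seq (z', i y) | y <- enum J].
pose L2 := [seq (i y, z') | y <- enum J].
(* If [z] is already a vertex, possibly [x], there may be repetitions or a loop; symmetry,
   connectedness and the bound by the sum over [L] persist. *)
pose L := L0 ++ [:: (i x, z'); (z', i x)] ++ L1 ++ L2.
pose e' : rel V' := fun a b => (a, b) \in L.
have e'old a b : e a b -> ~~ cut (a, b) -> e' (i a) (i b).
  move=> eab nc; rewrite /e' mem_cat; apply/orP; left; apply/mapP.
  by exists (a, b) => //; rewrite mem_enum inE/= eab.
have e'xz : e' (i x) z' by rewrite /e' !mem_cat !inE eqxx !orbT.
have e'zx : e' z' (i x) by rewrite /e' !mem_cat !inE eqxx !orbT.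
have e'zy y : y \in J -> e' z' (i y).
  move=> yJ; rewrite /e' !mem_cat; suff -> : (z', i y) \in L1 by rewrite !orbT.
  by apply/mapP; exists y; rewrite ?mem_enum.
have e'yz y : y \in J -> e' (i y) z'.
  move=> yJ; rewrite /e' !mem_cat; suff -> : (i y, z') \in L2 by rewrite !orbT.
  by apply/mapP; exists y; rewrite ?mem_enum.
have cutC a b : cut (a, b) = cut (b, a) by rewrite /cut/= orbC.
have sub' : forall a b, e' a b -> e' b a.
  move=> a b; rewrite {1}/e' !mem_cat => /or4P[/mapP[[c c']]|ab|/mapP[y]|/mapP[y]].
  - rewrite mem_enum inE/= => /andP[ecc nc] [-> ->].
    by apply: e'old; rewrite ?(sym c')// cutC.
  - by move: ab; rewrite !inE => /orP[]/eqP[-> ->].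
  - by rewrite mem_enum => yJ [-> ->]; exact: e'yz.
  - by rewrite mem_enum => yJ [-> ->]; exact: e'zy.
have sym' : symmetric e' by move=> a b; apply/idP/idP; exact: sub'.
have step a b : e a b -> connect e' (i a) (i b).
  move=> eab; have [|nc] := boolP (cut (a, b)); last exact/connect1/e'old.
  move=> /orP[]/andP[/= /eqP-> yJ].
    exact: connect_trans (connect1 e'xz) (connect1 (e'zy _ yJ)).
  exact: connect_trans (connect1 (e'yz _ yJ)) (connect1 e'zx).
have coni a b : connect e' (i a) (i b).
  have /connectP[s + ->] := con a b; elim: s a => [a _|c s IHs a /=/andP[ac cs]].
    exact: connect0.
  exact: connect_trans (step _ _ ac) (IHs _ cs).
have conx a : connect e' a (i x).
  have := fsvalP a; rewrite in_fset1U => /orP[/eqP az|aV].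
    by rewrite (_ : a = z'); [exact: connect1|exact: val_inj].
  by rewrite (_ : a = i [` aV]%fset); [exact: coni|exact: val_inj].
have con' a b : connect e' a b.
  by apply: (connect_trans (conx a)); rewrite (sym_connect_sym sym').
have n0 : (0 < #|{: V'}|)%N by apply/card_gt0P; exists z'.
have := SMT_le_connected smt (fsubset_trans SV VV') n0 sym' con'.
rewrite ler_pM2r ?invr_gt0// => len.
have := le_trans len (sum_rel_seq_le L (fun u v => nrm_ge0 (val u - val v))).
rewrite !big_cat/= !big_cons big_nil !big_map !big_enum/= addr0 => {}len.
have xnJ : x \notin J by apply/negP => /xJ; rewrite irr.
have old : \sum_(c | e c.1 c.2 && ~~ cut c) nrm (val c.1 - val c.2) +
   (\sum_(y in J) nrm (val x - val y) + \sum_(y in J) nrm (val y - val x)) <=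
   \sum_u \sum_(v | e u v) nrm (val u - val v).
  rewrite pair_big_dep/= [leRHS](bigID cut)/= [leRHS]addrC lerD2l.
  rewrite (bigID (fun c : V * V => c.1 == x))/=; apply: lerD.
    rewrite (eq_bigl (fun c : V * V => (c.1 == x) && (c.2 \in J))).
      by rewrite -(pair_big (pred1 x) (mem J) (fun u v => nrm (val u - val v)))/= big_pred1_eq.
    move=> [a b] /=; rewrite /cut/=; case: eqVneq => [->|_]; rewrite ?andbF//= andbT.
    by rewrite (negbTE xnJ) andbF orbF; apply: andb_idl => /xJ.
  rewrite (eq_bigl (fun c : V * V => (c.1 \in J) && (c.2 == x))).
    rewrite -(pair_big (mem J) (pred1 x) (fun u v => nrm (val u - val v)))/=.
    by under [leRHS]eq_bigr do rewrite big_pred1_eq.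
  move=> [a b] /=; rewrite /cut/=; case: eqVneq => [->|_]; rewrite ?andbF//= ?andbT.
    by rewrite (negbTE xnJ).
  by rewrite andbC [RHS]andbC; case: eqVneq => //= ->; apply: andb_idr => /xJ; rewrite sym.
have nC u v : nrm (u - v) = nrm (v - u) by rewrite -nrmN opprB.
have EA : \sum_(y in J) nrm (fsval x - fsval y) = \sum_(y in J) nrm (fsval y - fsval x).
  by apply: eq_bigr => y _.
have EB : \sum_(y in J) nrm (z - fsval y) = \sum_(y in J) nrm (fsval y - z).
  by apply: eq_bigr => y _.
by move: (le_trans old len) => /=; rewrite EA EB (nC (fsval x) z); lra.
Qed.

(** [SMT_split_le] for [m] chosen neighbours, with the vertex translated to the origin. *)
Lemma vertex_degree_edges (k m : nat) : vertex_degrees nrm k -> (m <= k)%N ->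
  exists w : 'I_m -> X, (forall i, w i != 0) /\
    forall (J : {set 'I_m}) z,
      \sum_(i in J) nrm (w i) <= nrm z + \sum_(i in J) nrm (w i - z).
Proof.
move=> [S [V [e [x [smt _ <-]]]]]; rewrite /degree; set N := [set y | e x y] => mN.
have [_ [_ _ irr _ _] _] := smt.
pose f (i : 'I_m) : V := enum_val (widen_ord mN i).
have fN i : e x (f i) by have := enum_valP (widen_ord mN i); rewrite inE.
have finj : injective f.
  by move=> i j /enum_val_inj E; apply: val_inj; exact: (congr1 val E).
exists (fun i => val (f i) - val x); split=> [i|J z].
  by rewrite subr_eq0; apply/negP => /eqP/val_inj xE; have := fN i; rewrite xE irr.
have sumJ (G : V -> R) : \sum_(y in f @: J) G y = \sum_(i in J) G (f i).
  by rewrite big_imset//= => i j _ _; exact: finj.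
have xJ y : y \in f @: J -> e x y by move=> /imsetP[i _ ->].
have := SMT_split_le (val x + z) smt xJ; rewrite !sumJ.
rewrite [val x + z]addrC addrK => /le_trans; apply.
rewrite lerD2l; apply: ler_sum => i _.
by rewrite opprD addrA addrAC.
Qed.

(** A Steiner point can be added to [S]: the tree stays minimal, since no new competitors arise. *)
Lemma steiner_sub_vertex_degrees :
  (steiner_degrees nrm `<=` vertex_degrees nrm)%classic.
Proof.
move=> k [S [V [e [x [[SV te min] xS <-]]]]].
exists (val x |` S)%fset, V, e, x; split; rewrite ?fset1U1//; split=> //.
  by rewrite fsubUset fsub1set SV fsvalP.
by move=> V' e' SV'; apply: min; apply: fsubset_trans SV'; exact: fsubsetU1.
Qed.

End SteinerTrees.

(** * Duality between l_p and l_q *)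

Section LpDuality.
Local Open Scope classical_set_scope.
Local Open Scope ring_scope.
Variables (R : realType) (d : nat) (p : R).
Hypothesis p2 : 2 <= p.
Let q : R := p / (p - 1).
Implicit Types (x v w f : 'rV[R]_d).

Let p0 : 0 < p. Proof. by move: p2; lra. Qed.
Let p1 : 0 < p - 1. Proof. by move: p2; lra. Qed.
Let q0 : 0 < q. Proof. by rewrite divr_gt0. Qed.
Let q1 : 0 < q - 1.
Proof.
rewrite /q -[X in _ - X](@divff _ (p - 1)) ?gt_eqF// -mulrBl subKr mul1r.
by rewrite invr_gt0.
Qed.
Let qp1 : (p - 1) * q = p. Proof. by rewrite /q mulrC divfK// gt_eqF. Qed.
Let pq1 : (q - 1) * p = q.
Proof. by rewrite /q; field; rewrite gt_eqF. Qed.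
Let conj_pq : p^-1 + q^-1 = 1.
Proof. by rewrite /q; field; rewrite !gt_eqF. Qed.

Lemma powsum_ge0 r x : 0 <= powsum r x.
Proof. by apply: sumr_ge0 => j _; exact: powR_ge0. Qed.

Lemma powsum_gt0 r x : x != 0 -> 0 < powsum r x.
Proof.
move=> x0; rewrite lt_def powsum_ge0 andbT; apply: contra x0 => /eqP /psumr_eq0P H.
apply/eqP/rowP => j; rewrite mxE; apply/eqP; rewrite -normr_eq0.
apply/eqP/(@powR_eq0_eq0 _ _ r)/H => // i _; exact: powR_ge0.
Qed.

Lemma powsumZ r t x : 0 <= t -> powsum r (t *: x) = t `^ r * powsum r x.
Proof.
move=> t0; rewrite mulr_sumr; apply: eq_bigr => j _.
by rewrite mxE normrM powRM// ger0_norm.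
Qed.

Lemma powsumN r x : powsum r (- x) = powsum r x.
Proof. by apply: eq_bigr => j _; rewrite mxE normrN. Qed.

Lemma powsum0 r : r != 0 -> powsum r (0 : 'rV[R]_d) = 0.
Proof. by move=> r0; rewrite /powsum big1// => j _; rewrite mxE normr0 powR0. Qed.

Lemma lp_normE x : lp_norm p d x = powsum p x `^ p^-1. Proof. by []. Qed.

Lemma lp_norm_ge0 x : 0 <= lp_norm p d x.
Proof. exact: powR_ge0. Qed.

Lemma lp_normN x : lp_norm p d (- x) = lp_norm p d x.
Proof. by rewrite !lp_normE powsumN. Qed.

Lemma lp_norm0 : lp_norm p d (0 : 'rV[R]_d) = 0.
Proof. by rewrite lp_normE powsum0 ?powR0 ?invr_eq0// gt_eqF. Qed.

Lemma lp_normZ t x : 0 <= t -> lp_norm p d (t *: x) = t * lp_norm p d x.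
Proof.
move=> t0; rewrite !lp_normE powsumZ// powRM ?powR_ge0 ?powsum_ge0//.
by rewrite -powRrM divff ?powRr1// gt_eqF.
Qed.

Lemma lp_norm_gt0 x : x != 0 -> 0 < lp_norm p d x.
Proof. by move=> x0; rewrite powR_gt0// powsum_gt0. Qed.

(** Hoelder's inequality, from Young's inequality in each coordinate after division of [x] by its
    norm. *)
Lemma dot_le_lp_norm f x : powsum q f <= 1 -> dot f x <= lp_norm p d x.
Proof.
move=> f1; have [->|x0] := eqVneq x 0.
  by rewrite lp_norm0 /dot big1// => j _; rewrite mxE mulr0.
have N0 := lp_norm_gt0 x0; set N := lp_norm p d x in N0 *.
have NX : N `^ p = powsum p x.
  by rewrite /N lp_normE -powRrM mulVf ?powRr1 ?powsum_ge0// gt_eqF.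
apply: (@le_trans _ _ (\sum_j N * (`|f ord0 j| `^ q / q + (`|x ord0 j| / N) `^ p / p))).
  apply: ler_sum => j _; apply: le_trans (ler_norm _) _; rewrite normrM.
  rewrite -[in leLHS](divfK (lt0r_neq0 N0) `|x ord0 j|) mulrCA [_ * N]mulrC mulrCA.
  by rewrite ler_pM2l// [leRHS]addrC conjugate_powR// divr_ge0// ltW.
rewrite -mulr_sumr -[leRHS]mulr1 ler_pM2l// big_split/= -!mulr_suml.
rewrite -conj_pq addrC; apply: lerD.
  have N0' := ltW N0.
  have NV : N^-1 `^ p = (N `^ p)^-1.
    by rewrite -powR_inv1// powRAC powR_inv1// powR_ge0.
  under eq_bigr do rewrite powRM ?invr_ge0// NV.
  rewrite -mulr_suml -/(powsum p x) NX divff ?mul1r//.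
  by rewrite gt_eqF// powsum_gt0.
by apply: ler_piMl => //; rewrite invr_ge0 ltW.
Qed.

(* The gradient of the norm at [x]; it is [0] at [x = 0]. *)
Definition dualvec x : 'rV[R]_d :=
  \row_j (x ord0 j * `|x ord0 j| `^ (p - 2) / powsum p x `^ q^-1).

Lemma mul_powRB2 (y r : R) : 0 < r - 1 -> `|y| * `|y| `^ (r - 2) = `|y| `^ (r - 1).
Proof. by move=> r1; rewrite -[RHS]mulr_powRB1//; congr (_ * _ `^ _); ring. Qed.

Lemma sqr_powRB2 (y r : R) : 0 < r - 1 -> y * (y * `|y| `^ (r - 2)) = `|y| `^ r.
Proof.
move=> r1; rewrite mulrA -expr2 -[y ^+ 2]real_normK ?num_real// expr2 -mulrA.
by rewrite mul_powRB2// mulr_powRB1//; lra.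
Qed.

Lemma dot_dualvec x : dot (dualvec x) x = lp_norm p d x.
Proof.
have [->|x0] := eqVneq x 0.
  by rewrite lp_norm0 /dot big1// => j _; rewrite !mxE mulr0.
have S0 := powsum_gt0 p x0.
have -> : dot (dualvec x) x = powsum p x / powsum p x `^ q^-1.
  rewrite mulr_suml; apply: eq_bigr => j _.
  by rewrite mxE mulrC mulrA sqr_powRB2.
have S1 := gt_eqF (powR_gt0 q^-1 S0).
apply: (mulIf (negbT S1)); rewrite divfK ?S1// lp_normE -powRD.
  by rewrite conj_pq powRr1 ?ltW.
by rewrite (gt_eqF S0) implybT.
Qed.

Lemma powsum_dualvec x : x != 0 -> powsum q (dualvec x) = 1.
Proof.
move=> x0; have S0 := powsum_gt0 p x0.
transitivity (\sum_j `|x ord0 j| `^ p / powsum p x); last first.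
  by rewrite -mulr_suml -/(powsum p x) divff// gt_eqF.
apply: eq_bigr => j _.
rewrite mxE normrM normfV normrM !(ger0_norm (powR_ge0 _ _)) mul_powRB2//.
rewrite powRM ?invr_ge0 ?powR_ge0// -powRrM qp1.
congr (_ * _).
rewrite -[(powsum p x `^ _)^-1]powR_inv1 ?powR_ge0// -!powRrM.
by rewrite mulrCA mulN1r mulVf ?gt_eqF// powR_inv1 ?ltW.
Qed.

(** Converse of Hoelder: the vector with entries f_j |f_j|^(q - 2) yields A <= A^(1/p) for
    [A = powsum q f], hence A^(1/q) <= 1 when [f] is nonzero. *)
Lemma powsum_le1 f : (forall v, dot f v <= lp_norm p d v) -> powsum q f <= 1.
Proof.
move=> fv; have [->|f0] := eqVneq f 0; first by rewrite powsum0 ?gt_eqF.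
have A0 := powsum_gt0 q f0; set A := powsum q f in A0 *.
pose v := \row_j (f ord0 j * `|f ord0 j| `^ (q - 2)).
have := fv v.
have -> : dot f v = A by apply: eq_bigr => j _; rewrite mxE sqr_powRB2.
have -> : lp_norm p d v = A `^ p^-1.
  rewrite lp_normE; congr (_ `^ _); apply: eq_bigr => j _.
  by rewrite mxE normrM (ger0_norm (powR_ge0 _ _)) mul_powRB2// -powRrM pq1.
have AE : A = A `^ p^-1 * A `^ q^-1.
  by rewrite -powRD ?conj_pq ?powRr1 ?ltW// (gt_eqF A0) implybT.
rewrite {1}AE ger_pMr ?powR_gt0// => h.
have : (A `^ q^-1) `^ q <= 1 `^ q.
  by apply: ge0_ler_powR; rewrite ?nnegrE ?powR_ge0 ?(ltW q0).
by rewrite powR1 -powRrM mulVf ?gt_eqF// (powRr1 (ltW A0)).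
Qed.

(** Convexity: the supporting functional of the norm at [w - t *: v], evaluated at [w], stays below
    the norm of [w]. *)
Lemma lp_norm_grad_le w v t : 0 <= t ->
  lp_norm p d (w - t *: v) + t * dot (dualvec (w - t *: v)) v <= lp_norm p d w.
Proof.
move=> t0; set u := w - _.
have -> : t * dot (dualvec u) v = dot (dualvec u) w - dot (dualvec u) u.
  rewrite -dotBr /u subKr /dot mulr_sumr; apply: eq_bigr => j _.
  by rewrite [(t *: v) _ _]mxE mulrCA.
rewrite dot_dualvec addrC subrK; have [->|u0] := eqVneq u 0.
  rewrite (_ : dualvec 0 = 0) ?dot0l ?lp_norm_ge0//.
  by apply/rowP => j; rewrite !mxE !mul0r.
by apply: dot_le_lp_norm; rewrite powsum_dualvec.
Qed.

Lemma continuous_mul_powR (y : R) : {for y, continuous (fun z : R => z * `|z| `^ (p - 2))}.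
Proof.
have [->|y0] := eqVneq y 0; last first.
  have ny0 : `|y| \in `]0, +oo[%R by rewrite in_itv/= andbT normr_gt0.
  apply: cvgM; first exact: cvg_id.
  apply: (@continuous_comp _ _ _ (fun z : R => `|z|) (fun z : R => z `^ (p - 2)) y).
    exact: norm_continuous.
  apply: differentiable_continuous; apply/derivable1_diffP.
  exact: derivable_powR.
rewrite /prop_for /continuous_at mul0r.
have n0 : `|z| @[z --> (0 : R)] --> (0 : R).
  have : `|z| @[z --> (0 : R)] --> `|0 : R| by exact: norm_continuous.
  by rewrite normr0.
(* Since [p >= 2], the factor |z|^(p - 2) is at most 1 near 0. *)
apply: (@squeeze_cvgr _ _ _ _ (fun z : R => - `|z|) (fun z : R => `|z|)).
- near=> z; have z1 : `|z| <= 1.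
    by near: z; apply: cvgr0_norm_le; [exact: cvg_id|exact: ltr01].
  have p20 : 0 <= p - 2 by rewrite subr_ge0.
  have b1 : `|z| `^ (p - 2) <= 1.
    apply: (@le_trans _ _ (1 `^ (p - 2))); last by rewrite powR1.
    by apply: ge0_ler_powR; rewrite ?nnegrE.
  have : `|z * `|z| `^ (p - 2)| <= `|z|.
    by rewrite normrM (ger0_norm (powR_ge0 _ _)) ler_piMr.
  by rewrite ler_norml.
- by rewrite -[X in _ --> X]oppr0; exact: cvgN.
- exact: n0.
Unshelve. all: by end_near. Qed.

Lemma cvg_sumr (I : Type) (s : seq I) (P : pred I) (F : I -> R -> R) (l : I -> R) (t : R) :
  (forall i, P i -> F i z @[z --> t] --> l i) ->
  \sum_(i <- s | P i) F i z @[z --> t] --> \sum_(i <- s | P i) l i.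
Proof. by move=> H; apply: cvg_big => //; exact: add_continuous. Qed.

Lemma cvg_dot_dualvec w v : w != 0 ->
  dot (dualvec (w - t *: v)) v @[t --> (0 : R)] --> dot (dualvec w) v.
Proof.
move=> w0.
have lin (j : 'I_d) : w ord0 j - t * v ord0 j @[t --> (0 : R)] --> w ord0 j.
  rewrite -[X in _ --> X]subr0 -[X in _ - X](mul0r (v ord0 j)).
  by apply: cvgB; [exact: cvg_cst|apply: cvgMl; exact: cvg_id].
have phi (j : 'I_d) : (w ord0 j - t * v ord0 j) * `|w ord0 j - t * v ord0 j| `^ (p - 2)
    @[t --> (0 : R)] --> w ord0 j * `|w ord0 j| `^ (p - 2).
  exact: (continuous_cvg _ (@continuous_mul_powR (w ord0 j)) (lin j)).
have S0 := powsum_gt0 p w0.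
have cS : powsum p (w - t *: v) @[t --> (0 : R)] --> powsum p w.
  apply: cvg_sumr => j _.
  under eq_fun do rewrite !mxE -sqr_powRB2//.
  by rewrite -sqr_powRB2//; exact: cvgM.
have cSq : powsum p (w - t *: v) `^ q^-1 @[t --> (0 : R)] --> powsum p w `^ q^-1.
  have cp : {for powsum p w, continuous (fun z : R => z `^ q^-1)}.
    apply: differentiable_continuous; apply/derivable1_diffP; apply: derivable_powR.
    by rewrite in_itv/= andbT.
  exact: (continuous_cvg _ cp cS).
apply: cvg_sumr => j _; apply: cvgMl.
under eq_fun do rewrite !mxE.
rewrite mxE; apply: cvgM; first exact: phi.
by apply: cvgV => //; rewrite gt_eqF ?powR_gt0.
Qed.

(* First-order form of the splitting inequality, as [z -> 0] along a ray. *)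
Lemma powsum_sum_dualvec_le1 (I : finType) (J : {set I}) (w : I -> 'rV[R]_d) :
  (forall i, i \in J -> w i != 0) ->
  (forall z, \sum_(i in J) lp_norm p d (w i) <=
     lp_norm p d z + \sum_(i in J) lp_norm p d (w i - z)) ->
  powsum q (\sum_(i in J) dualvec (w i)) <= 1.
Proof.
move=> w0 H; apply: powsum_le1 => v; rewrite dot_suml.
have cv : \sum_(i in J) dot (dualvec (w i - t *: v)) v @[t --> 0^'+] -->
    \sum_(i in J) dot (dualvec (w i)) v.
  apply: cvg_at_right_filter; apply: cvg_sumr => i iJ.
  by apply: cvg_dot_dualvec; exact: w0.
apply: (cvgr_to_le cv); near=> t; have t0 : 0 < t by [].
have t0' := ltW t0; rewrite -(ler_pM2l t0) -lp_normZ// mulr_sumr.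
rewrite -(lerD2r (\sum_(i in J) lp_norm p d (w i - t *: v))).
apply: le_trans (H _); rewrite -big_split/=; apply: ler_sum => i _.
by rewrite addrC lp_norm_grad_le.
Unshelve. all: by end_near. Qed.

End LpDuality.

(** * Degrees in l_p *)

Section LpSteiner.
Variables (R : realType) (p : R) (d : nat).
Hypothesis p2 : 2 <= p.
Let q : R := p / (p - 1).

(** Any [m <= k] edges may be kept, so refuting [m] vectors excludes all degrees from [m] on. *)
Lemma vertex_degree_dual (k m : nat) :
  vertex_degrees (lp_norm p d) k -> (m <= k)%N ->
  exists x : 'I_m -> 'rV[R]_d, (forall i, powsum q (x i) = 1) /\
    (forall J : {set 'I_m}, powsum q (\sum_(i in J) x i) <= 1).
Proof.
move=> vk mk.
have [w [w0 wJ]] := vertex_degree_edges (@lp_norm_ge0 R d p) (@lp_normN R d p) vk mk.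
exists (fun i => dualvec p (w i)); split=> [i|J]; first exact: powsum_dualvec.
by apply: powsum_sum_dualvec_le1 => // z; exact: wJ.
Qed.

(** The star from the origin to the terminals [s i] is calibrated by the labels [f i]: by the last
    hypothesis their pairing with the positions is the length of the star, and [calibration] makes
    it a lower bound for every competitor. *)
Lemma star_steiner_degree (k : nat) (s f : 'I_k -> 'rV[R]_d) :
  injective s -> (forall i, s i != 0) -> \sum_i f i = 0 ->
  (forall J : {set 'I_k}, powsum q (\sum_(i in J) f i) <= 1) ->
  (forall i, dot (f i) (s i) = lp_norm p d (s i)) ->
  steiner_degrees (lp_norm p d) k.
Proof.
move=> sinj s0 f0 fJ fs.
pose S : {fset 'rV[R]_d} := [fset s i | i in 'I_k]%fset.
pose V : {fset 'rV[R]_d} := (0 |` S)%fset.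
have sS i : s i \in S by apply/imfsetP; exists i.
have SV : (S `<=` V)%fset by exact: fsubsetU1.
have oS : 0 \notin S by apply/negP => /imfsetP[i _ /esym/eqP]; exact/negP.
pose o : V := [` fset1U1 0 S]%fset.
pose j i : V := fincl SV [` sS i]%fset.
have joP (y : V) : y != o -> exists i, y = j i.
  move=> yo; have := fsvalP y; rewrite in_fset1U => /orP[/eqP y0|/imfsetP[i _ yi]].
    by case/eqP: yo; exact: val_inj.
  by exists i; exact: val_inj.
pose e := parent_rel (fun=> o) o.
have te : is_tree e.
  by apply: (@parent_tree _ _ (fun y => nat_of_bool (y != o))) => y ->; rewrite eqxx.
have len : tree_length (lp_norm p d) e <= \sum_i lp_norm p d (s i).
  rewrite ler_pdivrMr// mulr_natr mulr2n.
  pose L := [seq (o, j i) | i <- enum 'I_k] ++ [seq (j i, o) | i <- enum 'I_k].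
  apply: (@le_trans _ _ (\sum_u \sum_(v | (u, v) \in L) lp_norm p d (val u - val v))).
    apply: ler_sum => u _; rewrite big_mkcond [leRHS]big_mkcond/=.
    apply: ler_sum => v _; case: ifP => [|_]; last by case: ifP => // _; exact: lp_norm_ge0.
    rewrite /e /parent_rel => uv; rewrite ifT// mem_cat.
    case/orP: uv => /andP[/joP[i ->] /eqP <-]; apply/orP; [right|left];
      by apply/mapP; exists i; rewrite ?mem_enum.
  apply: le_trans (sum_rel_seq_le L (fun u v => lp_norm_ge0 _ (val u - val v))) _.
  rewrite big_cat/=; apply: lerD; rewrite big_map big_enum/=; apply: ler_sum => i _.
    by rewrite sub0r lp_normN.
  by rewrite subr0.
exists S, V, e, o; split=> //.
  split=> // V' e' SV' te'; apply: le_trans len _.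
  pose iv i : V' := fincl SV' [` sS i]%fset.
  (* The sum is empty at the Steiner points of the competitor, so subset sums of [g] are subset sums
     of [f]. *)
  pose g v := \sum_(i | iv i == v) f i.
  have -> : \sum_i lp_norm p d (s i) = \sum_v dot (g v) (val v).
    rewrite (partition_big iv predT)//=; apply: eq_bigr => v _.
    by rewrite dot_suml; apply: eq_bigr => i /eqP <-; rewrite -fs.
  apply: (@calibration R d _ e' (lp_norm p d) g (fun v => val v) te').
  - by move=> v; exact: lp_norm_ge0.
  - by move=> v; exact: lp_normN.
  - by rewrite -[RHS]f0 [RHS](partition_big iv predT).
  move=> A v; apply: dot_le_lp_norm => //.
  have := fJ [set i | iv i \in A]; congr (powsum _ _ <= _).
  rewrite (partition_big iv (mem A))/=; last by move=> i; rewrite inE.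
  apply: eq_bigr => u uA; apply: eq_bigl => i; rewrite inE.
  by case: eqVneq => [->|]; rewrite ?andbF// uA.
rewrite /degree (_ : [set y | e o y] = [set~ o]); last first.
  by apply/setP => y; rewrite !inE /e /parent_rel eqxx/= andbT.
by rewrite cardsC1 -cardfE cardfsU1 oS/= card_imfset//= -cardE card_ord.
Qed.

Hypothesis d3 : (3 <= d)%N.

Lemma sum_ord3 (F : nat -> R) : (forall j, (3 <= j)%N -> F j = 0) ->
  \sum_(j < d) F j = F 0%N + F 1%N + F 2%N.
Proof.
move=> F0; rewrite -(big_mkord predT) (big_cat_nat (n := 3))//= [X in _ + X]big1_seq ?addr0.
  by rewrite !big_nat_recr//= big_nil add0r.
by move=> j; rewrite mem_index_iota => /andP[_ /andP[/F0]].
Qed.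

Section SignTables.
(* The rows of [tbl] are the terminals; [t] vanishes outside of the table. *)
Variable tbl : seq (seq int).
Let t (i j : nat) : int := nth 0 (nth [::] tbl i) j.
Let row3 (i : 'I_(size tbl)) : 'rV[R]_d := \row_(j < d) (t i j)%:~R.

(** Since |z|^e = |z| for z in {-1, 0, 1} and nonzero e, each row is a positive multiple of its own
    norming functional. *)
Lemma table_steiner_degree (r : nat) : (0 < r)%N ->
  (forall i j, (3 <= j)%N -> t i j = 0) ->
  (forall i i' : 'I_(size tbl),
    t i 0 = t i' 0 -> t i 1 = t i' 1 -> t i 2 = t i' 2 -> i = i') ->
  (forall i : 'I_(size tbl), all (fun z => `|z| <= 1) [:: t i 0; t i 1; t i 2]) ->
  (forall i : 'I_(size tbl), `|t i 0| + `|t i 1| + `|t i 2| = r%:Z) ->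
  (forall j, \sum_(i < size tbl) t i j = 0) ->
  (forall J : {set 'I_(size tbl)},
    \sum_(j < 3) `|(\sum_(i in J) t i j)%:~R| `^ q <= r%:R :> R) ->
  steiner_degrees (lp_norm p d) (size tbl).
Proof.
move=> r0 t3 tinj tle1 tr t0 tJ.
have rR : 0 < r%:R :> R by rewrite ltr0n.
have p1 : 1 < p by rewrite (lt_le_trans _ p2)// ltr1n.
have q0 : q != 0 by rewrite mulf_neq0 ?invr_neq0// gt_eqF// ?subr_gt0// (lt_trans ltr01).
have p0 : p != 0 by rewrite gt_eqF// (lt_trans ltr01).
have absp (z : int) e : e != 0 -> `|z| <= 1 -> `|z%:~R : R| `^ e = `|z|%:~R.
  move=> e0; rewrite -intr_norm; case: (`|z|) (normr_ge0 z) => // -[|[|n]] // _ _.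
    by rewrite powR0.
  by rewrite powR1.
have tle1' i j : `|t (i : 'I_(size tbl)) j| <= 1.
  have /and4P[a0 a1 a2 _] := tle1 i.
  by case: j => [|[|[|j]]] //; rewrite t3.
have sum_row e i : e != 0 -> \sum_(j < d) `|(t (i : 'I_(size tbl)) j)%:~R : R| `^ e = r%:R.
  move=> e0; rewrite (@sum_ord3 (fun j => `|(t i j)%:~R : R| `^ e)); last first.
    by move=> j /t3 ->; rewrite normr0 powR0.
  by rewrite !absp ?tle1'// -!intrD tr.
have powr i : powsum p (row3 i) = r%:R.
  by rewrite -(sum_row p i p0); apply: eq_bigr => j _; rewrite mxE.
(* This scales the rows to unit vectors of l_q; as 1/p + 1/q = 1, [c * r] is the l_p norm r^(1/p) of
   a row. *)
pose c : R := r%:R `^ (- q^-1).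
have c0 : 0 <= c by exact: powR_ge0.
apply: (@star_steiner_degree _ row3 (fun i => c *: row3 i)).
- move=> i i' ii'; have E (j : nat) (jd : (j < d)%N) : t i j = t i' j.
    have /rowP/(_ (Ordinal jd)) := ii'; rewrite !mxE => /eqP.
    by rewrite eqr_int => /eqP.
  by apply: tinj; apply: E; apply: leq_trans d3.
- move=> i; apply/eqP => /(congr1 (powsum p (d:=d))); rewrite powr powsum0// => /eqP.
  by rewrite gt_eqF.
- rewrite -scaler_sumr; apply/rowP => j; rewrite !mxE summxE.
  under eq_bigr do rewrite mxE.
  by rewrite -rmorph_sum/= t0 mulr0.
- move=> J; rewrite -scaler_sumr powsumZ// /c -powRrM mulNr mulVf// (powR_inv1 (ltW rR)).
  rewrite ler_pdivrMl// mulr1 (le_trans _ (tJ J))// le_eqVlt; apply/predU1P; left.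
  rewrite -(big_mkord predT (fun j => `|(\sum_(i in J) t i j)%:~R : R| `^ q)).
  rewrite !big_nat_recr//= big_nil add0r.
  rewrite -(@sum_ord3 (fun j => `|(\sum_(i in J) t i j)%:~R : R| `^ q)).
    apply: eq_bigr => j _; rewrite summxE rmorph_sum/=; congr (`|_| `^ _).
    by apply: eq_bigr => i _; rewrite mxE.
  by move=> j j3; rewrite big1 ?normr0 ?powR0// => i _; exact: t3.
- move=> i; have -> : dot (c *: row3 i) (row3 i) = c * r%:R.
    rewrite -(sum_row 2 i) ?pnatr_eq0// mulr_sumr; apply: eq_bigr => j _.
    rewrite !mxE -mulrA -expr2 powR_mulrn ?normr_ge0//.
    by rewrite real_normK ?num_real.
  rewrite lp_normE powr /c -{2}[r%:R]powRr1 ?ltW// -powRD.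
    by congr (_ `^ _); rewrite /q; field; rewrite ?p0 ?subr_eq0 gt_eqF.
  by rewrite (gt_eqF rR) implybT.
Qed.

End SignTables.

Lemma norm_intr_powR (z : int) (n : nat) : absz z = n -> `|z%:~R : R| `^ q = n%:R `^ q.
Proof. by move=> <-; rewrite -intr_norm. Qed.

(** Evaluates explicit integers, so that [lra] sees powers such as 2^q as atoms. *)
Ltac eval_norm_intr := repeat match goal with |- context [ `|intmul 1 ?z| ] =>
  let n := eval vm_compute in (absz z) in rewrite (@norm_intr_powR z n erefl) end.

(** Every nonempty proper subset sum of the rows is a row up to sign, with power sum 2. *)
Lemma steiner_degree3 : steiner_degrees (lp_norm p d) 3.
Proof.
have q0 : q != 0 by rewrite mulf_neq0 ?invr_neq0//; move: p2; lra.
apply: (@table_steiner_degree [:: [:: 1; -1; 0]; [:: 0; 1; -1]; [:: -1; 0; 1]] 2) => //.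
- by move=> [|[|[|i]]] [|[|[|j]]] //= _; rewrite !nth_nil.
- by move=> [[|[|[|i]]] ?] [[|[|[|i']]] ?] //= ? ? ?; exact: val_inj.
- by move=> [[|[|[|i]]] ?].
- by move=> [[|[|[|i]]] ?].
- by move=> [|[|[|j]]]; rewrite !big_ord_recl big_ord0 //= !nth_nil.
move=> J; rewrite !big_ord_recl big_ord0 !(big_mkcond (mem J))/= !big_ord_recl !big_ord0/=.
have a0 : 0%:R `^ q = 0 :> R by rewrite powR0.
have a1 : 1%:R `^ q = 1 :> R by rewrite powR1.
by do 3 case: ifP => _; eval_norm_intr; rewrite ?a0 ?a1; lra.
Qed.

(** The rows are the vertices of a regular tetrahedron. Sums of one or three have power sum 3; a sum
    of two has a single nonzero entry, 2 or -2, hence power sum 2^q. *)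
Lemma steiner_degree4 : 2 `^ q <= 3 -> steiner_degrees (lp_norm p d) 4.
Proof.
move=> Q; have q0 : q != 0 by rewrite mulf_neq0 ?invr_neq0//; move: p2; lra.
apply: (@table_steiner_degree
  [:: [:: 1; 1; 1]; [:: 1; -1; -1]; [:: -1; 1; -1]; [:: -1; -1; 1]] 3) => //.
- by move=> [|[|[|[|i]]]] [|[|[|j]]] //= _; rewrite !nth_nil.
- by move=> [[|[|[|[|i]]]] ?] [[|[|[|[|i']]]] ?] //= ? ? ?; exact: val_inj.
- by move=> [[|[|[|[|i]]]] ?].
- by move=> [[|[|[|[|i]]]] ?].
- by move=> [|[|[|j]]]; rewrite !big_ord_recl big_ord0 //= !nth_nil.
move=> J; rewrite !big_ord_recl big_ord0 !(big_mkcond (mem J))/= !big_ord_recl !big_ord0/=.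
have a0 : 0%:R `^ q = 0 :> R by rewrite powR0.
have a1 : 1%:R `^ q = 1 :> R by rewrite powR1.
by do 4 case: ifP => _; eval_norm_intr; rewrite ?a0 ?a1; lra.
Qed.

End LpSteiner.

(** * Maxima of bounded sets of degrees *)

Section Largest.
Local Open Scope nat_scope.

(** A nonempty bounded set has a maximum, so [xget] does not fall back on its default [0]. *)
Lemma largestP (A : set nat) (k m : nat) : A k -> ubound A m ->
  [/\ A (largest A), k <= largest A & largest A <= m].
Proof.
move=> Ak Am.
have exP : exists n, `[< A n >] by exists k; exact/asboolP.
have ubP n : `[< A n >] -> n <= m by move=> /asboolP/Am.
have [n /asboolP An maxn] := ex_maxnP exP ubP.
have An' : (A `&` ubound A)%classic n.
  by split=> // j Aj; apply: maxn; exact/asboolP.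
have [Al ubl] := xgetPex 0 (ex_intro _ n An').
by split=> //; [exact: ubl|exact: Am].
Qed.

Lemma largest_le (A B : set nat) (k m : nat) : A k -> (A `<=` B)%classic -> ubound B m ->
  [/\ k <= largest A, largest A <= largest B & largest B <= m].
Proof.
move=> Ak AB Bm.
have Am : ubound A m by move=> j /AB/Bm.
have [Al kA _] := largestP Ak Am.
have [_ lAB lB] := largestP (AB _ Al) Bm.
by split.
Qed.

End Largest.

(** Both sides say p ln a <= (p - 1) ln b; this turns bounds on powers into thresholds for [p]. *)
Lemma conj_powR_le (R : realType) (p a b : R) : 1 < p -> 0 < a -> a < b ->
  (a `^ (p / (p - 1)) <= b) = (ln b / (ln b - ln a) <= p).
Proof.
move=> p1 a0 ab; have b0 := lt_trans a0 ab.
have p10 : 0 < p - 1 by rewrite subr_gt0.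
have lab : 0 < ln b - ln a by rewrite subr_gt0 ltr_ln.
have -> : (a `^ (p / (p - 1)) <= b) = (ln (a `^ (p / (p - 1))) <= ln b).
  by rewrite ler_ln ?posrE ?powR_gt0.
rewrite ln_powR mulrAC ler_pdivrMr// ler_pdivrMr//.
by apply/idP/idP; lra.
Qed.

(** * Upper bounds on the degrees of vertices *)

Section DegreeBounds.
Variables (R : realType) (p : R) (d : nat).
Hypothesis p2 : 2 <= p.
Let q : R := p / (p - 1).
Let p10 : 0 < p - 1. Proof. by move: p2; lra. Qed.

Lemma conj_le2 : 0 < q <= 2.
Proof. by rewrite divr_gt0//= ?ler_pdivrMr//; move: p2; lra. Qed.

Lemma conj_lt2 : 2 < p -> 1 <= q < 2.
Proof. by move=> ?; rewrite ler_pdivlMr// ltr_pdivrMr//; apply/andP; split; lra. Qed.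

Lemma vertex_degrees_le3 : p < ln 3 / (ln 3 - ln 2) ->
  ubound (vertex_degrees (lp_norm p d)) 3%N.
Proof.
move=> hp k /(vertex_degree_dual p2) dual; rewrite leEnat leqNgt.
apply/negP => /dual[x [x1 xJ]].
have := card4_powR2_le x1 xJ conj_le2 (card_ord 4).
by rewrite conj_powR_le ?leNgt ?hp//; move: p2; lra.
Qed.

Lemma vertex_degrees_le4 : p < (ln 8 - ln 3) / (ln 4 - ln 3) ->
  ubound (vertex_degrees (lp_norm p d)) 4%N.
Proof.
move=> hp k /(vertex_degree_dual p2) dual; rewrite leEnat leqNgt.
apply/negP => /dual[x [x1 xJ]].
have := card5_powR2_le x1 xJ conj_le2 (card_ord 5).
rewrite conj_powR_le; try by move: p2; lra.
have -> : ln (8 / 3) = ln 8 - ln 3 :> R by rewrite ln_div ?posrE.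
have -> : ln 8 = ln 2 + ln 4 :> R by rewrite -lnM ?posrE//; congr ln; lra.
have -> : ln 2 + ln 4 - ln 3 - ln 2 = ln 4 - ln 3 :> R by lra.
have <- : ln 8 = ln 2 + ln 4 :> R by rewrite -lnM ?posrE//; congr ln; lra.
by rewrite leNgt hp.
Qed.

Lemma vertex_degrees_le5 : 2 < p -> p < ln 4 / (ln 4 - ln 3) ->
  ubound (vertex_degrees (lp_norm p d)) 5%N.
Proof.
move=> p2' hp k /(vertex_degree_dual p2) dual; rewrite leEnat leqNgt.
apply/negP => /dual[x [x1 xJ]].
have := card6_powR3_le x1 xJ (conj_lt2 p2') (card_ord 6).
by rewrite conj_powR_le ?leNgt ?hp//; lra.
Qed.

Lemma vertex_degrees_le6 : 2 < p -> ubound (vertex_degrees (lp_norm p d)) 6%N.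
Proof.
move=> p2' k /(vertex_degree_dual p2) dual; rewrite leEnat leqNgt.
apply/negP => /dual[x [x1 xJ]].
exact: (card_neq7 x1 xJ (conj_lt2 p2') (card_ord 7)).
Qed.

End DegreeBounds.

Theorem theorem8 (R : realType) (p : R) (d : nat) (hp : 2 <= p)
    (hd : (3 <= d)%N) :
  [/\ (p < ln 3 / (ln 3 - ln 2) ->
        s_max (lp_norm p d) = 3%N /\ v_max (lp_norm p d) = 3%N),
      (ln 3 / (ln 3 - ln 2) <= p < (ln 8 - ln 3) / (ln 4 - ln 3) ->
        s_max (lp_norm p d) = 4%N /\ v_max (lp_norm p d) = 4%N),
      (ln 3 / (ln 3 - ln 2) <= p < ln 4 / (ln 4 - ln 3) ->
        (4 <= s_max (lp_norm p d) <= v_max (lp_norm p d))%N /\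
        (v_max (lp_norm p d) <= 5)%N),
      (ln 3 / (ln 3 - ln 2) <= p < ln 4 / (ln 8 - ln 7) ->
        (4 <= s_max (lp_norm p d) <= v_max (lp_norm p d))%N /\
        (v_max (lp_norm p d) <= 6)%N) &
      (ln 3 / (ln 3 - ln 2) <= p ->
        (4 <= s_max (lp_norm p d) <= v_max (lp_norm p d))%N /\
        (v_max (lp_norm p d) <= 7)%N)].
Proof.
have deg4 : ln 3 / (ln 3 - ln 2) <= p -> steiner_degrees (lp_norm p d) 4.
  by move=> h; apply: steiner_degree4; rewrite ?conj_powR_le//; lra.
(* The threshold exceeds 2 because 3 < 4; hence [q < 2], as the moments require. *)
have gt2 : ln 3 / (ln 3 - ln 2) <= p -> 2 < p.
  apply: lt_le_trans; have l23 : ln 2 < ln 3 :> R by rewrite ltr_ln ?posrE// ltr_nat.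
  have l34 : ln 3 < ln 2 + ln 2 :> R by rewrite -lnM ?posrE// ltr_ln ?posrE//; lra.
  rewrite ltr_pdivlMr; lra.
have bnd k m : steiner_degrees (lp_norm p d) k -> ubound (vertex_degrees (lp_norm p d)) m ->
    (k <= s_max (lp_norm p d) <= v_max (lp_norm p d))%N /\ (v_max (lp_norm p d) <= m)%N.
  move=> sk vm.
  by have [-> -> ->] := largest_le sk (steiner_sub_vertex_degrees (nrm := lp_norm p d)) vm.
have sv k :
    (k <= s_max (lp_norm p d) <= v_max (lp_norm p d))%N /\ (v_max (lp_norm p d) <= k)%N ->
    s_max (lp_norm p d) = k /\ v_max (lp_norm p d) = k.
  move=> [/andP[ks svm] vk]; split; apply/eqP; rewrite eqn_leq.
    by rewrite ks (leq_trans svm).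
  by rewrite vk (leq_trans ks).
split=> [h|/andP[h h']|/andP[h h']|/andP[h _]|h].
- by apply/sv/bnd; [exact: steiner_degree3|exact: vertex_degrees_le3].
- by apply/sv/bnd; [exact: deg4|exact: vertex_degrees_le4].
- by apply: bnd; [exact: deg4|exact: vertex_degrees_le5 (gt2 h) h'].
- by apply: bnd; [exact: deg4|exact: vertex_degrees_le6 (gt2 h)].
- by apply: bnd; [exact: deg4|move=> k /(vertex_degrees_le6 hp (gt2 h))/leqW].
Qed.
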